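(* Let $\Lambda$ be a finite, strongly connected $k$-graph with adjacency matrices $A_1,\dots,A_k$ such that every vertex receives at least two edges of each color, i.e. $\sum_{b\in\Lambda^0}A_i(a,b)\ge2$ for all $a\in\Lambda^0$ and $1\le i\le k$. Suppose that $A=A_1\cdots A_k$ is irreducible. For any $\delta\in(0,1)$, let $\mu_\delta$ be the finite Borel measure on $X_{\mathcal B_\Lambda}$ determined by $\mu_\delta([\lambda])=\mathcal T(\pi_\tau(\chi_{[\lambda]})|D|^{-\delta})$ for $\lambda\in F\mathcal B_\Lambda$ ($\tau$ any choice function). Then the normalization $\nu_\delta$ of the measure $\mu_\delta$ on $X_{\mathcal B_\Lambda}$ defined by $$\nu_\delta(O)=\frac{\mu_\delta(O)}{\mu_\delta(X_{\mathcal B_\Lambda})}=\frac{\mathcal T(\pi_\tau(\chi_O)|D|^{-\delta})}{\mathcal T(|D|^{-\delta})}\qquad\text{for every Borel set }O\text{ of }X_{\mathcal B_\Lambda}$$ agrees with the measure $M$. In particular, $\nu_\delta$ is a probability measure which is independent of the choice of $\delta$.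
   Context: $\mathbb N=\{0,1,2,\dots\}$. A $k$-graph ($k\ge 1$) is a countable small category $\Lambda$ with a functor $d:\Lambda\to\mathbb N^k$ ($\mathbb N^k$ viewed as a one-object category under addition) such that whenever $d(\lambda)=m+n$ there are unique $\mu,\nu\in\Lambda$ with $d(\mu)=m$, $d(\nu)=n$, $\lambda=\mu\nu$. Here $\lambda\in\Lambda$ means $\lambda$ is a morphism; $\Lambda^n=d^{-1}(n)$; $\Lambda^0$ is identified with the objects (vertices); $r,s:\Lambda\to\Lambda^0$ are range and source. $\Lambda$ is finite if every $\Lambda^n$ is finite, and strongly connected if for all $v,w\in\Lambda^0$ there is $\lambda\in\Lambda$ with $r(\lambda)=v$, $s(\lambda)=w$. With $e_i$ the standard basis of $\mathbb N^k$, the adjacency matrices are $A_i(v,w)=\#\{\lambda\in\Lambda^{e_i}: r(\lambda)=v,\ s(\lambda)=w\}$; $\rho_i$ is the spectral radius of $A_i$. For $\Lambda$ finite and strongly connected, $x^\Lambda\in(0,\infty)^{\Lambda^0}$ is the unique positive vector with $\sum_v x^\Lambda_v=1$ and $A_ix^\Lambda=\rho_ix^\Lambda$ for $1\le i\le k$. The stationary $k$-Bratteli diagram $\mathcal B_\Lambda$ has vertex set $\bigsqcup_{n\ge0}\mathcal V_n$, each $\mathcal V_n$ a copy of $\Lambda^0$, and edge set $\bigsqcup_{n\ge1}\mathcal E_n$, where for $n\equiv i \pmod k$, $1\le i\le k$, $\mathcal E_n$ contains exactly $A_i(p,q)$ edges with range $p\in\mathcal V_{n-1}$ and source $q\in\mathcal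 V_n$. $F\mathcal B_\Lambda$ is the set of finite paths $\eta=\eta_1\cdots\eta_m$ ($\eta_i\in\mathcal E_i$, $s(\eta_i)=r(\eta_{i+1})$), of length $|\eta|=m$; vertices in $\mathcal V_0$ are the paths of length $0$. $X_{\mathcal B_\Lambda}$ is the set of infinite paths $(x_n)_{n\ge1}$, $x_n\in\mathcal E_n$, $s(x_n)=r(x_{n+1})$, with the topology generated by the cylinder sets $[\lambda]$ = set of infinite paths with initial segment $\lambda\in F\mathcal B_\Lambda$; $\chi_O$ is the characteristic function of a set $O\subseteq X_{\mathcal B_\Lambda}$. The measure $M$ (introduced by an Huef, Laca, Raeburn and Sims) is the Borel probability measure on $X_{\mathcal B_\Lambda}$ determined by $M([\lambda])=(\rho_1\cdots\rho_t)^{-(q+1)}(\rho_{t+1}\cdots\rho_k)^{-q}x^\Lambda_{s(\lambda)}$ for $\lambda\in F\mathcal B_\Lambda$ with $|\lambda|=qk+t$, $0\le t\le k-1$. For $\delta\in(0,1)$ and $|\eta|=qk+t$ with $q\in\mathbb N$, $0\le t\le k-1$, $$w_\delta(\eta)=\big(\rho_1^{q+1}\cdots\rho_t^{q+1}\rho_{t+1}^q\cdots\rho_k^q\big)^{-1/\delta}x^\Lambda_{s(\eta)}.$$ For $x\ne y$ in $X_{\mathcal B_\Lambda}$, $x\wedge y$ is the longest common initial segment in $F\mathcal B_\Lambda$ ($\emptyset$ if $r(x)\neq r(y)$); $d_\delta(x,y)=w_\delta(x\wedge y)$ if $x\wedge y\ne\emptyset$, $d_\delta(x,y)=1$ if $x\wedge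 y=\emptyset$, and $d_\delta(x,x)=0$; $\operatorname{diam}[\lambda]=\sup\{d_\delta(x,y):x,y\in[\lambda]\}$. Under the hypotheses of the claim, $w_\delta(\lambda)=\operatorname{diam}[\lambda]$ for all $\lambda\in F\mathcal B_\Lambda$, $X_{\mathcal B_\Lambda}$ is a Cantor set and $d_\delta$ is an ultrametric inducing its topology. A choice function is a map $\tau=(\tau_+,\tau_-):F\mathcal B_\Lambda\to X_{\mathcal B_\Lambda}\times X_{\mathcal B_\Lambda}$ with $\tau(\gamma)\in[\gamma]\times[\gamma]$ and $d_\delta(\tau_+(\gamma),\tau_-(\gamma))=\operatorname{diam}[\gamma]$. On $\mathcal H=\ell^2(F\mathcal B_\Lambda,\mathbb C^2)$, for a function $f$ on $X_{\mathcal B_\Lambda}$ (continuous, or the characteristic function of a Borel set), put $\pi_\tau(f)=\bigoplus_\gamma\mathrm{diag}(f(\tau_+(\gamma)),f(\tau_-(\gamma)))$, and let $D=\bigoplus_\gamma\frac1{\operatorname{diam}[\gamma]}\begin{pmatrix}0&1\\1&0\end{pmatrix}$; then $|D|^{-1}$ is multiplication by $\operatorname{diam}[\gamma]$ on the $\gamma$-summand. For a positive operator $T$ that is measurable in the sense of Connes (all Dixmier traces take the same value on $T$), $\mathcal T(T)=\lim_{s\searrow1}(s-1)\operatorname{Tr}(T^s)$ denotes its Dixmier trace. Under the hypotheses of the claim, $\pi_\tau(\chi_{[\lambda]})|D|^{-\delta}$ is positive and Connes measurable, so $\mu_\delta([\lambda])=\lim_{s\searrow1}(s-1)\operatorname{Tr}((\pi_\tau(\chi_{[\lambda]})|D|^{-\delta})^s)$;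 this number is finite, positive and independent of $\tau$, and there is a unique finite Borel measure $\mu_\delta$ with these values on cylinder sets.
   Formalization: The second equality (quotient of Dixmier traces) is proved only for Borel sets O with M-null topological boundary; it fails for general Borel O, e.g. O the countable set of all points τ₊(γ), τ₋(γ), where the quotient is 1 but μ_δ(O)=0. *)

(* Defs.v *)
From HB Require Import structures.
From mathcomp Require Import all_boot all_order all_algebra.
From mathcomp Require Import finmap spectral complex.
From mathcomp Require Import all_classical all_reals all_analysis.

Set Implicit Arguments.
Unset Strict Implicit.
Unset Printing Implicit Defensive.

Import Order.TTheory GRing.Theory Num.Theory.
Import numFieldNormedType.Exports.

Local Open Scope classical_set_scope.
Local Open Scope ring_scope.

(* A k-graph with set of objects V, presented as a category with one type of
   morphisms; [kcomp m n h] is the composite mn, defined when s(m) = r(n).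
   Objects are kept apart from morphisms of degree 0, the identification being
   v |-> [kid v]. *)
Record kgraph (k : nat) (V : countType) := KGraph {
  kmor : countType;
  krng : kmor -> V;
  ksrc : kmor -> V;
  kid : V -> kmor;
  kcomp : forall m n : kmor, ksrc m = krng n -> kmor;
  kdeg : kmor -> {ffun 'I_k -> nat};
  krng_id : forall v, krng (kid v) = v;
  ksrc_id : forall v, ksrc (kid v) = v;
  krng_comp : forall m n (h : ksrc m = krng n), krng (kcomp h) = krng m;
  ksrc_comp : forall m n (h : ksrc m = krng n), ksrc (kcomp h) = ksrc n;
  kcomp1m : forall m (h : ksrc (kid (krng m)) = krng m), kcomp h = m;
  kcompm1 : forall m (h : ksrc m = krng (kid (ksrc m))), kcomp h = m;
  kcompA : forall l m n (hlm : ksrc l = krng m) (hmn : ksrc m = krng n)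
    (hl : ksrc l = krng (kcomp hmn)) (hr : ksrc (kcomp hlm) = krng n),
    kcomp hl = kcomp hr;
  kdeg_id : forall v, kdeg (kid v) = 0;
  kdeg_comp : forall m n (h : ksrc m = krng n),
    kdeg (kcomp h) = kdeg m + kdeg n;
  kfactor : forall l (a b : {ffun 'I_k -> nat}), kdeg l = a + b ->
    exists! p : kmor * kmor, [/\ kdeg p.1 = a, kdeg p.2 = b &
      exists h : ksrc p.1 = krng p.2, l = kcomp h]
}.

Definition unit_deg (k i : nat) : {ffun 'I_k -> nat} :=
  [ffun j : 'I_k => (nat_of_ord j == i) : nat].

(* Colours are numbered from 0: colour i stands for e_(i+1), A_(i+1) and
   rho_(i+1), and only i < k is meaningful. *)
Section Graph.
Variables (k : nat) (V : finType) (L : kgraph k V).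

Definition finite_kgraph :=
  forall a : {ffun 'I_k -> nat}, finite_set [set m : kmor L | kdeg m = a].

Definition strongly_connected :=
  forall v w : V, exists m : kmor L, krng m = v /\ ksrc m = w.

Definition nedges (i : nat) (v w : V) : nat :=
  #|` fset_set [set m : kmor L |
        [/\ kdeg m = unit_deg k i, krng m = v & ksrc m = w]]|.

Definition adjacency (i : nat) : 'M[nat]_#|V| :=
  \matrix_(a, b) nedges i (enum_val a) (enum_val b).

Definition receives_two :=
  forall (i : nat) (a : V), (i < k)%N -> (2 <= \sum_(b : V) nedges i a b)%N.

End Graph.

Definition irreducible_mx n (A : 'M[nat]_n) :=
  forall i j, exists2 m : nat, (0 < m)%N & (0 < (A ^+ m) i j)%N.

Definition spectral_radius (R : realType) n (A : 'M[nat]_n) : R :=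
  sup [set complex.Re `|z| | z in
        [set z : R[i] | eigenvalue (map_mx (fun m : nat => m%:R : R[i]) A) z]].

Section Bratteli.
Variables (k : nat) (V : finType) (L : kgraph k V).

(* The edge (p, q, j), with j < A_i(p, q), is the j-th edge with range p and
   source q.  [bedge_at n] is the set of edges E_(n+1), so that its colour,
   numbered from 0, is n mod k. *)
Definition bedge : Type := (V * V * nat)%type.
HB.instance Definition _ := Countable.on bedge.

Definition brng (e : bedge) : V := e.1.1.
Definition bsrc (e : bedge) : V := e.1.2.

Definition bedge_at (n : nat) : pred bedge :=
  fun e => (e.2 < nedges L (n %% k) (brng e) (bsrc e))%N.

Fixpoint is_fin_path (n : nat) (v : V) (s : seq bedge) : bool :=
  if s is e :: s' then
    [&& brng e == v, bedge_at n e & is_fin_path n.+1 (bsrc e) s']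
  else true.

(* The pair (v, [:: eta_1; ...; eta_m]) is the path eta_1 ... eta_m of range v;
   (v, [::]) is the vertex v of V_0. *)
Definition fin_path := {p : V * seq bedge | is_fin_path 0 p.1 p.2}.
HB.instance Definition _ := Countable.on fin_path.

Definition flen (l : fin_path) : nat := size (val l).2.
Definition fsrc (l : fin_path) : V := last (val l).1 (map bsrc (val l).2).

Record inf_path := IPath {
  ipath_edge :> nat -> bedge;
  ipath_edgeP : forall n,
    bedge_at n (ipath_edge n) /\ bsrc (ipath_edge n) = brng (ipath_edge n.+1)
}.
HB.instance Definition _ := gen_eqMixin inf_path.
HB.instance Definition _ := gen_choiceMixin inf_path.

Definition irng (y : inf_path) : V := brng (y 0%N).

Definition cylinder (l : fin_path) : set inf_path :=
  [set y | (irng y, mkseq y (flen l)) = val l].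

HB.instance Definition _ :=
  @isSubBaseTopological.Build inf_path (set inf_path) (range cylinder) id.

(* A measurableType is pointed, hence the proof [h] that the path space is not
   empty; it only serves to choose the point. *)
Definition path_space (h : [set: inf_path] !=set0) : Type := inf_path.
HB.instance Definition _ h := Topological.on (path_space h).
HB.instance Definition _ h := isPointed.Build (path_space h) (projT1 (cid h)).

Definition borel_space (h : [set: inf_path] !=set0) :=
  g_sigma_algebraType (@open (path_space h)).

End Bratteli.

Section Metric.
Variables (R : realType) (k : nat) (V : finType) (L : kgraph k V).

Definition rho (i : nat) : R := spectral_radius R (adjacency L i).

Definition perron_vector (x : V -> R) :=
  [/\ forall v, 0 < x v,
      \sum_v x v = 1 &
      forall i, (i < k)%N -> forall v,
        \sum_w (nedges L i v w)%:R * x w = rho i * x v].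

Lemma path_space_neq0 (x : V -> R) :
  (0 < k)%N -> receives_two L -> perron_vector x -> [set: inf_path L] !=set0.
Proof.
move=> k_gt0 two [_ x1 _].
have [v0 _] : exists v0 : V, true.
  case: (pickP [pred v : V | true]) => [v0 _|V0]; first by exists v0.
  by move: x1; rewrite big_pred0 // => /esym/eqP; rewrite oner_eq0.
have step (n : nat) (v : V) : {w | (0 < nedges L (n %% k) v w)%N}.
  apply: sigW; apply/not_existsP => none.
  have := two (n %% k)%N v (ltn_pmod n k_gt0).
  rewrite big1 // => w _; apply/eqP; rewrite -leqn0 leqNgt.
  by apply/negP; exact: none.
pose v := fix v n := if n is m.+1 then projT1 (step m (v m)) else v0.
have vP n : bedge_at L n (v n, v n.+1, 0%N) /\
    bsrc (v n, v n.+1, 0%N) = brng (v n.+1, v n.+2, 0%N).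
  by split=> //; rewrite /bedge_at /=; exact: (projT2 (step n (v n))).
by exists (IPath vP).
Qed.

Variables (x : V -> R) (delta : R).

(* rho_1^(q+1) ... rho_t^(q+1) rho_(t+1)^q ... rho_k^q for m = qk + t. *)
Definition rho_weight (m : nat) : R :=
  (\prod_(0 <= i < m %% k) rho i ^+ (m %/ k).+1) *
  (\prod_(m %% k <= i < k) rho i ^+ (m %/ k)).

Definition weight (l : fin_path L) : R :=
  rho_weight (flen l) `^ (- delta^-1) * x (fsrc l).

Definition is_longest_common (y z : inf_path L) (l : fin_path L) :=
  [/\ cylinder l y, cylinder l z &
      forall l', cylinder l' y -> cylinder l' z -> (flen l' <= flen l)%N].

(* y /\ z; None stands for the empty segment, i.e. for r(y) != r(z).  The value
   at y = z is also None and is never used. *)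
Definition common_segment (y z : inf_path L) : option (fin_path L) :=
  xget None [set Some l | l in is_longest_common y z].

Definition ultradist (y z : inf_path L) : R :=
  if y == z then 0
  else if common_segment y z is Some l then weight l else 1.

Definition diam (l : fin_path L) : R :=
  sup [set ultradist y z | y in cylinder l & z in cylinder l].

Definition choice_function (tau : fin_path L -> inf_path L * inf_path L) :=
  forall l, [/\ cylinder l (tau l).1, cylinder l (tau l).2 &
                ultradist (tau l).1 (tau l).2 = diam l].

End Metric.

(* Functional calculus f(A) of a Hermitian matrix A. *)
Definition herm_calculus (R : realType) n (f : R -> R) (A : 'M[R[i]]_n) :
    'M[R[i]]_n :=
  invmx (spectralmx A) *m
  diag_mx (map_mx (fun z => (f (complex.Re z))%:C%C) (spectral_diag A)) *m
  spectralmx A.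

Section Operators.
Variables (R : realType) (k : nat) (V : finType) (L : kgraph k V).

(* A (possibly unbounded) operator on l^2(FB, C^2) that is block diagonal,
   T = (+)_gamma T_gamma, is given by the family of its 2 x 2 blocks.  Products,
   functional calculus and trace of such operators are taken blockwise. *)
Definition block_op : Type := fin_path L -> 'M[R[i]]_2.

Definition block_mul (S T : block_op) : block_op := fun l => S l *m T l.

Definition block_calculus (f : R -> R) (T : block_op) : block_op :=
  fun l => herm_calculus f (T l).

(* T^s for T >= 0 and s > 0; recall that 0 `^ s = 0 for s != 0. *)
Definition block_pow (T : block_op) (s : R) : block_op :=
  block_calculus (fun u => u `^ s) T.

(* Trace of a positive operator. *)
Definition block_trace (T : block_op) : \bar R :=
  \esum_(l in [set: fin_path L]) (complex.Re (\tr (T l)))%:E.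

(* Dixmier trace of a positive measurable operator, by the residue formula. *)
Definition dixmier_trace (T : block_op) : \bar R :=
  lim (((s - 1)%:E * block_trace (block_pow T s))%E @[s --> 1^'+]).

Variables (x : V -> R) (delta : R).

Definition pi_rep (tau : fin_path L -> inf_path L * inf_path L)
    (f : inf_path L -> R) : block_op :=
  fun l => diag_mx (\row_(i < 2)
    (if i == 0 then f (tau l).1 else f (tau l).2)%:C%C).

Definition dirac_op : block_op :=
  fun l => ((diam x delta l)^-1)%:C%C *: \matrix_(i < 2, j < 2) (i != j)%:R.

(* |D|^(- delta) *)
Definition abs_dirac_pow : block_op :=
  block_calculus (fun u => `|u| `^ (- delta)) dirac_op.

(* T(pi_tau(chi_O) |D|^(- delta)) *)
Definition dixmier_on (tau : fin_path L -> inf_path L * inf_path L)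
    (O : set (inf_path L)) : \bar R :=
  dixmier_trace (block_mul (pi_rep tau (\1_O : inf_path L -> R)) abs_dirac_pow).

End Operators.

Arguments dirac_op {R k V} L x delta _.
Arguments abs_dirac_pow {R k V} L x delta _.

Section Measures.
Variables (R : realType) (k : nat) (V : finType) (L : kgraph k V).
Variables (h : [set: inf_path L] !=set0) (x : V -> R).

Definition is_M (M : set (borel_space h) -> \bar R) :=
  forall l : fin_path L,
    M (cylinder l) = ((rho_weight R L (flen l))^-1 * x (fsrc l))%:E.

Definition is_mu (delta : R) (tau : fin_path L -> inf_path L * inf_path L)
    (mu : set (borel_space h) -> \bar R) :=
  choice_function x delta tau /\
  forall l : fin_path L, mu (cylinder l) = dixmier_on x delta tau (cylinder l).

Definition normalization (mu : set (borel_space h) -> \bar R)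
    (O : set (borel_space h)) : \bar R := (mu O / mu setT)%E.

(* The set O of all points tau_+(gamma), tau_-(gamma) is countable, so it is Borel
   and M-null, while pi_tau(chi_O) = 1: Dixmier traces compute the normalized
   measure of cylinders, clopen sets and, more generally, Borel sets with M-null
   boundary, but not of all Borel sets. *)
Definition topological_boundary (O : set (borel_space h)) :
    set (borel_space h) :=
  @closure (path_space h) O `\` @interior (path_space h) O.

End Measures.

(* Main.v *)
Require Import Defs.
From HB Require Import structures.
From mathcomp Require Import all_boot all_order all_algebra.
From mathcomp Require Import finmap spectral complex.
From mathcomp Require Import all_classical all_reals all_analysis.
From mathcomp Require Import lra ring.

Set Implicit Arguments.
Unset Strict Implicit.
Unset Printing Implicit Defensive.

Import Order.TTheory GRing.Theory Num.Theory.
Import numFieldNormedType.Exports.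

Local Open Scope classical_set_scope.
Local Open Scope ring_scope.

(** Since [diam l = weight l], the trace of [(pi_tau(chi_O) |D|^(-delta))^s] is
    the sum over finite paths [l] of [rho_weight(|l|)^(-s) x_(s(l))^(delta s)]
    times the number of points [tau_+(l)], [tau_-(l)] in [O].  For a cylinder
    starting at level [n] and vertex [v] this is, up to finitely many terms,
    twice a Dirichlet series [U_s(n, v)], and [U_s(0, .)] solves the renewal
    equation [U = S_s + rho^(-s) A U] with [A = A_1 ... A_k] and
    [rho = rho_1 ... rho_k].  As [rho] is a simple eigenvalue of the irreducible
    matrix [A], [(s - 1) U_s(n, v)] tends to [C x_v / rho_weight(n)], where [C]
    depends on neither [n] nor [v]: the Dixmier trace is [2 C] times the
    [M]-measure of the cylinder.  A Borel set with [M]-null boundary is squeezed between unions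
    of cylinders of a fixed large length. *)

(** The source term S_s carries the factors x_v^(delta s), which need not form an eigenvector of A,
    so U_s is not simply a geometric series times x. The residue removes this difficulty: in the
    limit only the pairing of S_1 with a left Perron vector of A survives, and it multiplies x. All
    dependence on delta is collected in that scalar, hence in C, and the normalization cancels it.
    Since s tends to 1 along the reals, the only singularity met is that of I - rho^(-s) A at the
    eigenvalue rho itself; other eigenvalues of modulus rho, which a periodic A has, do not
    interfere. The choice function disappears before the limit is taken: both points of tau(l) lie
    in [l], so they contribute 2 or 0 unless [l] meets both O and its complement. *)

(** * Limits as s decreases to 1, and the pole of a geometric series *)

Lemma cvg_powR_exp (R : realType) (T : Type) (F : set_system T) (FF : Filter F)
    (a : R) (f : T -> R) (l : R) :
  0 < a -> f t @[t --> F] --> l -> a `^ (f t) @[t --> F] --> a `^ l.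
Proof.
move=> a0 fl; rewrite /powR gt_eqF//.
by apply: continuous_cvg; [exact: continuous_expR | exact: cvgMl].
Qed.

Lemma cvg_bigsum (R : realType) (T I : Type) (F : set_system T) (FF : Filter F)
    (r : seq I) (P : pred I) (f : I -> T -> R) (l : I -> R) :
  (forall i, P i -> f i t @[t --> F] --> l i) ->
  (\sum_(i <- r | P i) f i t) @[t --> F] --> \sum_(i <- r | P i) l i.
Proof.
move=> fl; elim: r => [|i r ih].
  by under eq_fun do rewrite big_nil; rewrite big_nil; exact: cvg_cst.
under eq_fun do rewrite big_cons; rewrite big_cons.
case: ifPn => // Pi; exact: cvgD (fl _ Pi) ih.
Qed.

Lemma cvg_subr_right (R : realType) : (s - 1 : R) @[s --> 1^'+] --> (0 : R)^'.
Proof.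
move=> P; rewrite /= /nbhs/= /dnbhs /within /= => -[e /= e0 Pe].
exists e => //= s /= se s1; apply: Pe; last by rewrite subr_eq0 gt_eqF.
by rewrite /ball/= in se *; rewrite sub0r opprB.
Qed.

Lemma cvg_subr1_right (R : realType) : (s - 1 : R) @[s --> 1^'+] --> (0 : R).
Proof.
by rewrite -(subrr 1); apply: cvgB; [exact: cvg_at_right_filter | exact: cvg_cst].
Qed.

Lemma cvg_right1 (R : realType) (f g : R -> R) (l : R) :
  (forall s, 1 < s -> f s = g s) -> g s @[s --> 1^'+] --> l ->
  f s @[s --> 1^'+] --> l.
Proof.
move=> fg; apply: cvg_trans; apply: near_eq_cvg; near=> s.
by apply/esym/fg; near: s; exact: nbhs_right_gt.
Unshelve. all: by end_near.
Qed.

Lemma powR_lt1 (R : realType) (a e : R) : 1 < a -> e < 0 -> a `^ e < 1.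
Proof.
move=> a1 e0; rewrite -[ltRHS](powRr0 a) /powR gt_eqF ?(lt_trans _ a1)//.
by rewrite ltr_expR ltr_pM2r ?ln_gt0.
Qed.

(** With h = s - 1, the inverse of the quotient is the difference quotient at 0 of h |-> 1 - r^(-h),
    whose derivative there is ln r. *)
Lemma cvg_geometric_pole (R : realType) (r : R) : 1 < r ->
  (s - 1) / (1 - r `^ (1 - s)) @[s --> 1^'+] --> (ln r)^-1.
Proof.
move=> r1; have lr0 : 0 < ln r by rewrite ln_gt0.
have d : is_derive (0 : R) (1 : R) (fun h : R => 1 - expR (- h * ln r)) (ln r).
  apply: is_derive_eq; rewrite /= oppr0 mul0r expR0 !scaler0 /GRing.scale/=; lra.
have := @ex_derive _ _ _ _ _ _ _ d; rewrite /derivable => /cvg_ex[l cl].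
have lE : l = ln r.
  by rewrite -(@derive_val _ _ _ _ _ _ _ d) /derive; apply/esym/cvg_lim.
rewrite lE in cl.
have {}cl := cvg_comp _ _ (@cvg_subr_right R) cl.
have {cl} := cvgV (lt0r_neq0 lr0) cl.
move=> cl; apply: cvg_trans; last exact: cl.
apply: near_eq_cvg; near=> s => /=.
rewrite /GRing.scale/= mulr1 addr0 oppr0 mul0r expR0 subrr subr0 invfM invrK.
rewrite /powR gt_eqF ?(lt_trans _ r1)// opprB//.
Unshelve. all: by end_near.
Qed.

(** * The resolvent of an irreducible matrix at its Perron root *)

Section PerronFrobenius.
Variables (R : realType) (n : nat) (B : 'M[R]_n) (x : 'cV[R]_n) (r : R).
Hypotheses (Bge0 : forall i j, 0 <= B i j).
Hypothesis Birr : forall i j, exists m : nat, 0 < (B ^+ m) i j.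
Hypotheses (x0 : forall i, 0 < x i 0) (r1 : 1 < r) (Bx : B *m x = r *: x).

Let r0 : 0 < r. Proof. exact: lt_trans r1. Qed.

Lemma expmx_ge0 m i j : 0 <= (B ^+ m) i j.
Proof.
elim: m i j => [|m ih] i j; first by rewrite expr0 mxE; case: eqP.
by rewrite exprS mxE; apply: sumr_ge0 => l _; rewrite mulr_ge0.
Qed.

Lemma expmx_eigen (h : 'cV[R]_n) m : B *m h = r *: h -> B ^+ m *m h = r ^+ m *: h.
Proof.
move=> Bh; elim: m => [|m ih]; first by rewrite !expr0 mul1mx scale1r.
by rewrite exprSr -mulmxA Bh -scalemxAr ih scalerA -exprS.
Qed.

(** Minimum principle: for c the least ratio h_i / x_i, the vector z = h - c x is nonnegative,
    satisfies Bz = rz and vanishes at some i1. Row i1 of B^m z = r^m z is a sum of nonnegative terms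
    equal to 0, and irreducibility carries the zero to every index. *)
Lemma perron_simple (h : 'cV[R]_n) : B *m h = r *: h -> exists c, h = c *: x.
Proof.
move=> Bh; case: (pickP [pred i : 'I_n | true]) => [i0 _|I0]; last first.
  by exists 0; apply/matrixP => i; have := I0 i.
have [i1 _ i1min] := @arg_minP _ _ _ i0 xpredT (fun i => h i 0 / x i 0) isT.
pose c := h i1 0 / x i1 0; exists c.
pose z := h - c *: x.
have z0 i : 0 <= z i 0.
  rewrite !mxE subr_ge0 -ler_pdivlMr//; exact: i1min.
have z1 : z i1 0 = 0 by rewrite !mxE divfK ?subrr// gt_eqF.
have Bz : B *m z = r *: z.
  by rewrite mulmxBr -scalemxAr Bx Bh scalerBr !scalerA mulrC.
suff : z = 0 by move/eqP; rewrite subr_eq0 => /eqP.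
apply/matrixP => i j; rewrite !mxE ord1.
have [m Bm] := Birr i1 i.
have := expmx_eigen m Bz => /matrixP/(_ i1 0); rewrite [RHS]mxE z1 mulr0 mxE.
move=> /eqP; rewrite psumr_eq0 => [|l _]; last by rewrite mulr_ge0// expmx_ge0.
move=> /allP/(_ i); rewrite mem_index_enum => /(_ isT).
by rewrite mulf_eq0 (gt_eqF Bm)/= !mxE => /eqP.
Qed.

(* If uB = ru, then |u|B - r|u| >= 0, and pairing with x > 0 shows that it
   vanishes. *)
Lemma perron_left : (0 < n)%N -> exists y : 'rV[R]_n,
  [/\ forall i, 0 <= y 0 i, y *m B = r *: y & 0 < (y *m x) 0 0].
Proof.
move=> n0.
have : \det (B - r%:M) = 0.
  rewrite -det_tr; apply/eqP/det0P; exists x^T.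
    apply/negP => /eqP/matrixP/(_ 0 (Ordinal n0)); rewrite !mxE => xx0.
    by have := x0 (Ordinal n0); rewrite xx0 ltxx.
  by rewrite -trmx_mul mulmxBl Bx mul_scalar_mx subrr trmx0.
move/eqP/det0P => [u u0 uB].
have {}uB : u *m B = r *: u.
  by move/eqP : uB; rewrite mulmxBr mul_mx_scalar subr_eq0 => /eqP.
pose y : 'rV[R]_n := \row_i `|u 0 i|.
have y0 i : 0 <= y 0 i by rewrite mxE.
have yx : 0 < (y *m x) 0 0.
  have /rV0Pn[i ui] := u0.
  rewrite mxE (bigD1 i)//= ltr_pwDl//; first by rewrite mulr_gt0// mxE normr_gt0.
  by apply: sumr_ge0 => j _; rewrite mulr_ge0// ltW.
exists y; split=> //.
pose d := y *m B - r *: y.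
have d0 i : 0 <= d 0 i.
  rewrite !mxE subr_ge0 -{1}(gtr0_norm r0) -normrM.
  have /matrixP/(_ 0 i) := uB; rewrite !mxE => <-.
  apply: le_trans (ler_norm_sum _ _ _) _.
  by apply: ler_sum => j _; rewrite mxE normrM (ger0_norm (Bge0 _ _)).
have : (d *m x) 0 0 = 0.
  by rewrite mulmxBl -mulmxA Bx -scalemxAl -scalemxAr subrr mxE.
rewrite mxE => /eqP; rewrite psumr_eq0 => [|l _]; last by rewrite mulr_ge0// ltW.
move=> /allP dx; apply/eqP; rewrite -subr_eq0; apply/eqP/matrixP => i j.
rewrite ord1 [RHS]mxE; have := dx j; rewrite mem_index_enum => /(_ isT).
by rewrite mulf_eq0 (gt_eqF (x0 j)) orbF => /eqP.
Qed.

(* With y a left Perron vector, pairing the equation with y gives the limit of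
   (s - 1) yU(s); and I - B / r + xy is invertible, because the eigenvalue r is
   simple, so that this limit determines the one of (s - 1) U(s). *)
Lemma perron_residue (U S : R -> 'cV[R]_n) (S1 : 'cV[R]_n) (K : R) :
  (0 < n)%N ->
  (forall s, 1 < s -> U s = S s + r `^ (- s) *: (B *m U s)) ->
  (forall i, S s i 0 @[s --> 1^'+] --> S1 i 0) ->
  (forall i, 0 < S1 i 0) ->
  (\forall s \near 1^'+, forall i, `|(s - 1) * U s i 0| <= K) ->
  exists2 C, 0 < C & forall i, (s - 1) * U s i 0 @[s --> 1^'+] --> C * x i 0.
Proof.
move=> n0 US SS1 S10 UK.
have [y [y0 yB yx]] := perron_left n0.
(* Pairing with y gives the scalar equation yU = yS + r^(1 - s) yU, solved by a geometric series; c
   is the residue of its solution. *)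
pose c := (ln r)^-1 * (y *m S1) 0 0.
have rs s : r `^ (- s) * r = r `^ (1 - s).
  by rewrite -{2}(powRr1 (ltW r0)) -powRD ?(gt_eqF r0) ?implybT// addrC.
have yU : (s - 1) * (y *m U s) 0 0 @[s --> 1^'+] --> c.
  have : (s - 1) / (1 - r `^ (1 - s)) * (y *m S s) 0 0 @[s --> 1^'+] --> c.
    apply: cvgM; first exact: cvg_geometric_pole.
    under eq_fun do rewrite mxE.
    by rewrite mxE; apply: cvg_bigsum => i _; exact: cvgMr.
  move=> yl; apply: cvg_trans; last exact: yl.
  apply: near_eq_cvg; near=> s.
  have s1 : 1 < s by near: s; exact: nbhs_right_gt.
  have : (y *m U s) 0 0 = (y *m S s) 0 0 + r `^ (1 - s) * (y *m U s) 0 0.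
    rewrite {1}(US _ s1) mulmxDr -scalemxAr mulmxA yB -scalemxAl scalerA rs.
    by rewrite mxE; congr (_ + _); rewrite mxE.
  have p : r `^ (1 - s) < 1 by rewrite powR_lt1// subr_lt0.
  move=> e; rewrite -mulrA; congr (_ * _).
  have -> : (y *m S s) 0 0 = (1 - r `^ (1 - s)) * (y *m U s) 0 0.
    by rewrite mulrBl mul1r {1}e addrK.
  by rewrite mulrA mulVf ?mul1r// gt_eqF// subr_gt0.
pose P := 1%:M - r^-1 *: B + x *m y.
have yxE : y *m x = ((y *m x) 0 0)%:M by exact: mx11_scalar.
have NxE : (1%:M - r^-1 *: B) *m x = 0.
  by rewrite mulmxBl mul1mx -scalemxAl Bx scalerA mulVf ?gt_eqF// scale1r subrr.
have yNE : y *m (1%:M - r^-1 *: B) = 0.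
  by rewrite mulmxBr mulmx1 -scalemxAr yB scalerA mulVf ?gt_eqF// scale1r subrr.
have Px : P *m x = (y *m x) 0 0 *: x.
  by rewrite mulmxDl NxE add0r -mulmxA {1}yxE mul_mx_scalar.
(* If Pz = 0, pairing with y, which kills I - B / r, gives yz = 0. Then Bz = rz, so z is a multiple
   of x, and yx > 0 makes it zero. *)
have PU : P \in unitmx.
  rewrite -unitmx_tr -row_free_unit -kermx_eq0; apply/rowV0P => v.
  move=> /sub_kermxP vP; have {vP} Pz : P *m v^T = 0.
    by apply: trmx_inj; rewrite trmx_mul trmxK vP trmx0.
  have yz : y *m v^T = 0.
    have : y *m (P *m v^T) = 0 by rewrite Pz mulmx0.
    rewrite mulmxA mulmxDr yNE add0r mulmxA yxE mul_scalar_mx -scalemxAl.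
    by move=> /eqP; rewrite scaler_eq0 gt_eqF//= => /eqP.
  have Bz : B *m v^T = r *: v^T.
    move: Pz; rewrite mulmxDl -mulmxA yz mulmx0 addr0 mulmxBl mul1mx -scalemxAl.
    move=> /eqP; rewrite subr_eq0 => /eqP/(congr1 ( *:%R r)).
    by rewrite scalerA divff ?gt_eqF// scale1r => ->.
  have [a va] := perron_simple Bz.
  apply: trmx_inj; rewrite trmx0 va; move: yz; rewrite va -scalemxAr => /eqP.
  rewrite scaler_eq0 => /orP[/eqP->|/eqP yx0]; first by rewrite scale0r.
  by move: yx; rewrite yx0 mxE ltxx.
have PVx : invmx P *m x = ((y *m x) 0 0)^-1 *: x.
  apply: (canRL (scalerK (lt0r_neq0 yx))).
  by rewrite scalemxAr -Px mulmxA mulVmx// mul1mx.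
exists (c / (y *m x) 0 0).
  rewrite divr_gt0// mulr_gt0 ?invr_gt0 ?ln_gt0// mxE.
  have /existsP[i yi] : [exists i, y 0 i != 0].
    apply/contraT; rewrite negb_exists => /forallP yy.
    move: yx; rewrite mxE big1 ?ltxx// => i _; have /negPn/eqP -> := yy i.
    by rewrite mul0r.
  rewrite (bigD1 i)//= ltr_pwDl//; first by rewrite mulr_gt0// lt_def yi y0.
  by apply: sumr_ge0 => j _; rewrite mulr_ge0// ltW.
(* This is P applied to (s - 1) U(s), with U replaced through its equation. The factor r^(-s) is
   compared with the r^(-1) of P; the error in the middle term tends to 0 because (s - 1) U(s) is
   bounded by K. *)
pose w s : 'cV[R]_n := (s - 1) *: S s
  + (r `^ (- s) - r^-1) *: (B *m ((s - 1) *: U s))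
  + ((s - 1) * (y *m U s) 0 0) *: x.
have wc i : w s i 0 @[s --> 1^'+] --> c * x i 0.
  have s10 := @cvg_subr1_right R.
  rewrite -[c * _]add0r -[X in X + _]addr0.
  under eq_fun do rewrite mxE; apply: cvgD; last first.
    under eq_fun do rewrite mxE; apply: cvgM => //; exact: cvg_cst.
  under eq_fun do rewrite mxE; apply: cvgD.
    under eq_fun do rewrite mxE; rewrite -(mul0r (S1 i 0)).
    by apply: cvgM.
  have -> : (0 : R) = \sum_(j < n) B i j * 0.
    by rewrite big1// => j _; rewrite mulr0.
  have E s : ((r `^ (- s) - r^-1) *: (B *m ((s - 1) *: U s))) i 0 =
     \sum_(j < n) B i j * ((r `^ (- s) - r^-1) * ((s - 1) * U s j 0)).
    rewrite mxE mxE big_distrr/=; apply: eq_bigr => j _.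
    by rewrite mxE mulrCA.
  under eq_fun do rewrite E.
  apply: cvg_bigsum => j _; apply: cvgMr; apply: norm_cvg0.
  have h0 : `|r `^ (- s) - r^-1| * K @[s --> 1^'+] --> (0 : R).
    rewrite -(mul0r K); apply: cvgMl; rewrite -(normr0 R); apply: cvg_norm.
    rewrite -(subrr r^-1); apply: cvgB; last exact: cvg_cst.
    rewrite -[X in _ --> X]powR_inv1 ?ltW//; apply: cvg_powR_exp => //.
    by apply: cvgN; exact: cvg_at_right_filter.
  apply: (squeeze_cvgr _ (cvg_cst 0) h0); near=> s.
  rewrite normr_ge0/= normrM ler_wpM2l//.
  by move: j; near: s.
have UE : \forall s \near 1^'+, (s - 1) *: U s = invmx P *m w s.
  near=> s.
  have s1 : 1 < s by near: s; exact: nbhs_right_gt.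
  apply: (canRL (mulKmx PU)); rewrite /w mulmxDl -mulmxA.
  have -> : x *m (y *m ((s - 1) *: U s)) = ((s - 1) * (y *m U s) 0 0) *: x.
    by rewrite -!scalemxAr -scalerA {1}(mx11_scalar (y *m U s)) mul_mx_scalar.
  congr (_ + _).
  rewrite mulmxBl mul1mx -scalemxAl {1}(US _ s1) scalerDr.
  rewrite [(_ `^ _ - _) *: _]scalerBl -addrA.
  congr (_ + _); congr (_ - _); rewrite -scalemxAr !scalerA; congr (_ *: _).
  by rewrite mulrC.
move=> i; have -> : c / (y *m x) 0 0 * x i 0 = \sum_j invmx P i j * (c * x j 0).
  transitivity (c * (invmx P *m x) i 0); first by rewrite PVx [in RHS]mxE mulrA.
  by rewrite mxE big_distrr/=; apply: eq_bigr => j _; rewrite mulrCA.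
have : (\sum_j invmx P i j * w s j 0) @[s --> 1^'+] -->
    \sum_j invmx P i j * (c * x j 0).
  by apply: cvg_bigsum => j _; apply: cvgMr.
move=> wl; apply: cvg_trans; last exact: wl.
apply: near_eq_cvg; near=> s.
have : (s - 1) *: U s = invmx P *m w s by near: s.
by move=> /matrixP/(_ i 0); rewrite !mxE.
Unshelve. all: by end_near.
Qed.

End PerronFrobenius.

(** * Functional calculus of the blocks *)

Section HermitianCalculus.
Variables (R : realType) (n : nat) (f : R -> R) (A : 'M[R[i]]_n) (c : R).
Hypothesis Anormal : A \is normalmx.

Let d := spectral_diag A.
Let P := spectralmx A.

(** The eigenvalues of A are among c and -c, which an even f does not distinguish, so the chosen
    diagonalization is irrelevant. The blocks of D are of this kind. *)
Lemma herm_calculus_scalar : 0 <= c -> A *m A = ((c ^+ 2)%:C%C)%:M ->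
  (forall u, f u = f `|u|) -> herm_calculus f A = ((f c)%:C%C)%:M.
Proof.
move=> c0 AA fE; have Pu : P \in unitmx := spectral_unit A.
have AE : A = invmx P *m diag_mx d *m P := orthomx_spectralP Anormal.
have dd : diag_mx d *m diag_mx d = ((c ^+ 2)%:C%C)%:M.
  have : P *m (A *m A) *m invmx P = ((c ^+ 2)%:C%C)%:M.
    by rewrite AA mul_mx_scalar -scalemxAl mulmxV// scalemx1.
  by rewrite {1 2}AE !mulmxA mulmxV// mul1mx !mulmxK.
have dc i : f (complex.Re (d 0 i)) = f c.
  move/matrixP : dd => /(_ i i); rewrite mul_diag_mx !mxE eqxx !mulr1n => dd.
  move: dd => /eqP; rewrite rmorphXn -expr2 eqf_sqr => /orP[] /eqP ->//=.
  by rewrite fE normrN -fE.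
have -> : herm_calculus f A = invmx P *m ((f c)%:C%C)%:M *m P.
  rewrite /herm_calculus; congr (_ *m _ *m _).
  apply/matrixP => i j; rewrite !mxE; case: (eqVneq i j) => [->|//].
  by rewrite !mulr1n dc.
by rewrite mul_mx_scalar -scalemxAl mulVmx// scalemx1.
Qed.

(** A is c times a projection: its eigenvalues are 0, where f vanishes, and c. The blocks of
    pi_tau(chi_O) |D|^(- delta) are of this kind. *)
Lemma herm_calculus_proj : c != 0 -> A *m A = c%:C%C *: A -> f 0 = 0 ->
  herm_calculus f A = (f c / c)%:C%C *: A.
Proof.
move=> c0 AA f0; have Pu : P \in unitmx := spectral_unit A.
have AE : A = invmx P *m diag_mx d *m P := orthomx_spectralP Anormal.
have dd : diag_mx d *m diag_mx d = c%:C%C *: diag_mx d.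
  have : P *m (A *m A) *m invmx P = c%:C%C *: (P *m A *m invmx P).
    by rewrite AA -scalemxAr -scalemxAl.
  by rewrite {1 2 3}AE !mulmxA mulmxV// mul1mx !mulmxK.
rewrite {2}AE /herm_calculus scalemxAl scalemxAr; congr (_ *m _ *m _).
apply/matrixP => i j; rewrite !mxE.
case: (eqVneq i j) => [_|_]; last by rewrite !mulr0n mulr0.
rewrite !mulr1n.
move/matrixP : dd => /(_ i i); rewrite mul_diag_mx !mxE eqxx !mulr1n.
move=> /eqP; rewrite -subr_eq0 -mulrBl mulf_eq0 => /orP[|/eqP ->]; last first.
  by rewrite /= f0 mulr0.
rewrite subr_eq0 => /eqP ->/=.
by rewrite -rmorphM/= divfK.
Qed.

End HermitianCalculus.

Lemma herm_normal (R : realType) n (A : 'M[R[i]]_n) :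
  A^T = A -> (forall i j, (A i j)^* = A i j)%C -> A \is normalmx.
Proof.
move=> AT AC; apply/normalmxP; suff -> : map_mx Num.conj A^T = A by [].
by rewrite AT; apply/matrixP => i j; rewrite mxE; exact: AC.
Qed.

Section Blocks.
Variables (R : realType) (k : nat) (V : finType) (L : kgraph k V).
Variables (x : V -> R) (delta : R) (tau : fin_path L -> inf_path L * inf_path L).

Lemma abs_dirac_powE (l : fin_path L) : 0 < diam x delta l ->
  abs_dirac_pow L x delta l = ((diam x delta l `^ delta)%:C%C)%:M.
Proof.
move=> l0; rewrite /abs_dirac_pow /block_calculus.
rewrite (@herm_calculus_scalar _ _ _ _ (diam x delta l)^-1) ?invr_ge0 1?ltW//.
- rewrite gtr0_norm ?invr_gt0// -powR_inv1 1?ltW// -powRrM mulN1r opprK//.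
- apply: herm_normal.
    by apply/matrixP => i j; rewrite !mxE eq_sym.
  by move=> i j; rewrite !mxE -(rmorph_nat (real_complex R)) -rmorphM/= oppr0.
- rewrite /dirac_op -scalemxAl -scalemxAr scalerA -rmorphM -expr2.
  have -> : (\matrix_(i < 2, j < 2) (i != j)%:R : 'M[R[i]]_2) *m
     \matrix_(i < 2, j < 2) (i != j)%:R = 1%:M.
    apply/matrixP => i j; rewrite !mxE !big_ord_recl big_ord0 !mxE.
    by case: i => [[|[|//]]] ?; case: j => [[|[|//]]] ?;
      rewrite /= ?mulr0 ?mul0r ?mulr1 ?addr0 ?add0r.
  by rewrite scalemx1.
- by move=> u; rewrite normr_id.
Qed.

(** The trace of the projection that is the block of pi_tau(chi_O) at [l]. *)
Definition hits (O : set (inf_path L)) (l : fin_path L) : R :=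
  \1_O (tau l).1 + \1_O (tau l).2.

Lemma trace_dixmier (O : set (inf_path L)) (s : R) (l : fin_path L) :
  s != 0 -> 0 < diam x delta l ->
  complex.Re (\tr (block_pow (block_mul (pi_rep tau (\1_O : inf_path L -> R))
    (abs_dirac_pow L x delta)) s l)) = diam x delta l `^ (delta * s) * hits O l.
Proof.
move=> s0 l0; rewrite /block_pow /block_calculus /block_mul abs_dirac_powE//.
set c := _ `^ delta; have c0 : 0 < c by rewrite powR_gt0.
set T := pi_rep _ _ _; rewrite mul_mx_scalar.
have TT : T *m T = T.
  apply/matrixP => i j; rewrite /T mul_diag_mx !mxE.
  case: (eqVneq i j) => [_|_]; last by rewrite !mulr0n mulr0.
  rewrite !mulr1n -rmorphM/=; congr (_ %:C)%C; case: ifP => _.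
    by rewrite !indicE; case: (_ \in _); rewrite ?mulr1 ?mulr0.
  by rewrite !indicE; case: (_ \in _); rewrite ?mulr1 ?mulr0.
rewrite (@herm_calculus_proj _ _ _ _ c) ?gt_eqF ?powR0//.
- rewrite scalerA -rmorphM/= divfK ?gt_eqF// /c -powRrM.
  rewrite linearZ/= /hits /T mxtrace_diag !big_ord_recl big_ord0 !mxE/= addr0.
  by rewrite mul0r subr0.
- apply: herm_normal.
    by rewrite linearZ/= /T tr_diag_mx.
  move=> i j; rewrite !mxE.
  case: (eqVneq i j) => [_|_]; rewrite ?mulr1n ?mulr0n ?mulr0 ?rmorph0//.
  by rewrite -rmorphM/= oppr0.
- by rewrite -scalemxAl -scalemxAr TT.
Qed.

End Blocks.

(** * Enumeration of finite paths *)

Section Paths.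
Variables (k : nat) (V : finType) (L : kgraph k V).

Definition edges_from (n : nat) (v : V) : seq (bedge V) :=
  [seq (v, w, i) | w <- enum V, i <- iota 0 (nedges L (n %% k) v w)].

(** The starting level [n] is a parameter because removing the first edge of a path shifts the
    colours of the others. *)
Fixpoint paths_from (j n : nat) (v : V) : seq (seq (bedge V)) :=
  if j is j'.+1 then
    [seq e :: p | e <- edges_from n v, p <- paths_from j' n.+1 (bsrc e)]
  else [:: [::]].

Definition psrc (v : V) (p : seq (bedge V)) : V := last v (map (@bsrc V) p).

Lemma mem_edges_from n v e :
  (e \in edges_from n v) = (brng e == v) && bedge_at L n e.
Proof.
case: e => [[v' w'] i']; apply/allpairsPdep/andP => /=.
  move=> [w [i [_]]]; rewrite mem_iota add0n => /= iw [-> -> ->].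
  by rewrite /brng /bedge_at /=.
rewrite /brng /bedge_at /= => -[/eqP -> iw].
by exists w', i'; rewrite mem_enum mem_iota.
Qed.

Lemma edges_from_uniq n v : uniq (edges_from n v).
Proof.
apply: allpairs_uniq_dep; first exact: enum_uniq.
  by move=> w _; exact: iota_uniq.
by move=> [w i] [w' i'] _ _ /= [-> ->].
Qed.

Lemma mem_paths_from j n v p :
  (p \in paths_from j n v) = (size p == j) && is_fin_path L n v p.
Proof.
elim: j n v p => [|j ih] n v p.
  by rewrite inE; case: p.
case: p => [|e p].
  by apply/negbTE/negP => /allpairsPdep[? [? []]].
rewrite /= eqSS; apply/allpairsPdep/and3P => /=.
  move=> [e' [p' [+ + [-> ->]]]].
  by rewrite mem_edges_from ih => /andP[-> ->] /andP[-> ->].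
move=> [/eqP pj ev /andP[eb pp]]; exists e, p.
by rewrite mem_edges_from ev eb ih pj eqxx pp.
Qed.

Lemma paths_from_uniq j n v : uniq (paths_from j n v).
Proof.
elim: j n v => // j ih n v; apply: allpairs_uniq_dep => //.
  exact: edges_from_uniq.
by move=> [e p] [e' p'] _ _ /= [-> ->].
Qed.

Lemma is_fin_path_cat n v p q : is_fin_path L n v (p ++ q) =
  is_fin_path L n v p && is_fin_path L (n + size p) (psrc v p) q.
Proof.
elim: p n v => [|e p ih] n v /=; first by rewrite addn0.
by rewrite ih addSnnS !andbA.
Qed.

Lemma psrc_cat v p q : psrc v (p ++ q) = psrc (psrc v p) q.
Proof. by rewrite /psrc map_cat last_cat. Qed.

Definition level (j : nat) : seq (fin_path L) :=
  pmap insub [seq (v, p) | v <- enum V, p <- paths_from j 0 v].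

Lemma mem_level j l : (l \in level j) = (flen l == j).
Proof.
rewrite mem_pmap_sub; case: l => [[v p] vp]; rewrite /flen /=.
apply/allpairsPdep/eqP => /=.
  by move=> [v' [p' [_ + [_ ->]]]]; rewrite mem_paths_from => /andP[/eqP].
by move=> pj; exists v, p; rewrite mem_enum mem_paths_from pj eqxx.
Qed.

Lemma level_uniq j : uniq (level j).
Proof.
apply: pmap_sub_uniq; apply: allpairs_uniq_dep; first exact: enum_uniq.
  by move=> v _; exact: paths_from_uniq.
by move=> [v p] [v' p'] _ _ /= [-> ->].
Qed.

Section Sums.
Variable R : realType.

Lemma big_paths_fromS j n v (F : seq (bedge V) -> R) :
  \sum_(p <- paths_from j.+1 n v) F p =
  \sum_(e <- edges_from n v) \sum_(p <- paths_from j n.+1 (bsrc e)) F (e :: p).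
Proof. by rewrite /= big_allpairs_dep. Qed.

Lemma big_paths_from_cat i j n v (F : seq (bedge V) -> R) :
  \sum_(p <- paths_from (i + j) n v) F p =
  \sum_(p <- paths_from i n v) \sum_(q <- paths_from j (n + i) (psrc v p)) F (p ++ q).
Proof.
elim: i n v F => [|i ih] n v F; first by rewrite addn0 big_seq1.
rewrite addSn !big_paths_fromS; apply: eq_bigr => e _.
by rewrite ih addSnnS.
Qed.

Lemma big_edges_from n v (F : V -> R) :
  \sum_(e <- edges_from n v) F (bsrc e) = \sum_w (nedges L (n %% k) v w)%:R * F w.
Proof.
rewrite big_allpairs_dep big_enum /=; apply: eq_bigr => w _.
by rewrite /bsrc/= big_const_seq count_predT size_iota iter_addr_0 mulr_natl.
Qed.

Lemma big_paths_from_psrc j n v (F : V -> R) :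
  \sum_(p <- paths_from j.+1 n v) F (psrc v p) =
  \sum_w (nedges L (n %% k) v w)%:R *
    \sum_(p <- paths_from j n.+1 w) F (psrc w p).
Proof.
rewrite big_paths_fromS.
exact: (big_edges_from n v (fun w => \sum_(p <- paths_from j n.+1 w) F (psrc w p))).
Qed.

(* None when p does not continue l. *)
Definition extend (l : fin_path L) (p : seq (bedge V)) : option (fin_path L) :=
  insub ((val l).1, (val l).2 ++ p).

(** Paths of length i + j are grouped by their initial segment of length i. The default value 0 is
    never taken: every listed [p] continues [l]. *)
Lemma big_level i j (F : fin_path L -> R) :
  \sum_(l <- level (i + j)) F l =
  \sum_(l <- level i) \sum_(p <- paths_from j i (fsrc l)) oapp F 0 (extend l p).
Proof.
rewrite /level !big_pmap !big_allpairs_dep /=; apply: eq_bigr => v _.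
rewrite big_paths_from_cat big_seq [RHS]big_seq; apply: eq_bigr => p.
rewrite mem_paths_from => /andP[_ vp].
by rewrite (insubT (fun x => is_fin_path L 0 x.1 x.2)
  (_ : is_fin_path L 0 (v, p).1 (v, p).2)).
Qed.

Lemma extendP l j p : p \in paths_from j (flen l) (fsrc l) ->
  exists l' : fin_path L, [/\ extend l p = Some l',
     val l' = ((val l).1, (val l).2 ++ p), flen l' = (flen l + j)%N &
     fsrc l' = psrc (fsrc l) p].
Proof.
case: l => [[v q] vq]; rewrite mem_paths_from /flen /fsrc /= => /andP[/eqP pj pp].
have h : is_fin_path L 0 (v, q ++ p).1 (v, q ++ p).2.
  by rewrite /= is_fin_path_cat add0n; apply/andP.
exists (exist (fun x => is_fin_path L 0 x.1 x.2) _ h); split => //.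
- by rewrite /extend insubT.
- by rewrite /flen /= size_cat pj.
- by rewrite /fsrc/= -[LHS]/(psrc v (q ++ p)) psrc_cat.
Qed.

Lemma esum_level (F : fin_path L -> R) : (forall l, 0 <= F l) ->
  (\esum_(l in [set: fin_path L]) (F l)%:E =
   \sum_(0 <= j <oo) (\sum_(l <- level j) F l)%:E)%E.
Proof.
move=> F0.
rewrite (_ : [set: fin_path L] = \bigcup_j [set` level j]); last first.
  by apply/esym/seteqP; split=> // l _; exists (flen l) => //=; rewrite mem_level.
rewrite esum_bigcupT; last 2 first.
- by move=> i j _ _ [l [/=]]; rewrite !mem_level => /eqP <- /eqP.
- by move=> l; rewrite lee_fin.
rewrite -nneseries_esumT; last first.
  by move=> j; apply: esum_ge0 => l _; rewrite lee_fin.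
apply: eq_eseriesr => j _; rewrite esum_fset; last 2 first.
- exact: finite_seq.
- by move=> l _; rewrite lee_fin.
by rewrite -fsbig_seq ?level_uniq// sumEFin.
Qed.

End Sums.
End Paths.

(** * Dirichlet series of paths *)

Section Asymptotics.
Variables (R : realType) (k : nat) (V : finType) (L : kgraph k V) (x : V -> R).
Hypotheses (hk : (0 < k)%N) (htwo : receives_two L) (hx : perron_vector L x).

Let x_gt0 v : 0 < x v. Proof. by case: hx. Qed.
Let sum_x : \sum_v x v = 1. Proof. by case: hx. Qed.
Let x_eigen i v : (i < k)%N ->
  \sum_w (nedges L i v w)%:R * x w = rho R L i * x v.
Proof. by move=> ik; case: hx => _ _; apply. Qed.

Lemma perron_le1 v : x v <= 1.
Proof.
rewrite -sum_x (bigD1 v)//= lerDl; apply: sumr_ge0 => w _; exact: ltW.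
Qed.

Lemma perron_min : exists v0, forall v, x v0 <= x v.
Proof.
case: (pickP [pred v : V | true]) => [v0 _|V0]; last first.
  by move: sum_x; rewrite big_pred0// => /esym/eqP; rewrite oner_eq0.
by have [v1 _ v1P] := @arg_minP _ _ _ v0 xpredT x isT; exists v1 => v; exact: v1P.
Qed.

(** At a vertex where x is minimal, the eigenvalue equation sums at least two terms, each no smaller
    than that minimum. The resulting exponential growth of [rho_weight] makes the path series
    converge for s > 1. *)
Lemma rho_ge2 i : (i < k)%N -> 2 <= rho R L i.
Proof.
move=> ik; have [v0 v0P] := perron_min.
rewrite -(ler_pM2r (x_gt0 v0)) -x_eigen//.
apply: (@le_trans _ _ (\sum_w (nedges L i v0 w)%:R * x v0)).
  by rewrite -big_distrl/= ler_pM2r// -natr_sum ler_nat htwo.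
by apply: ler_sum => w _; rewrite ler_wpM2l.
Qed.

Let rho_mod_ge2 n : 2 <= rho R L (n %% k).
Proof. by apply: rho_ge2; rewrite ltn_mod. Qed.

Lemma rho_weightS n : rho_weight R L n.+1 = rho_weight R L n * rho R L (n %% k).
Proof.
rewrite /rho_weight.
have tk : (n %% k < k)%N by rewrite ltn_mod.
have nE : n.+1 = (n %/ k * k + (n %% k).+1)%N by rewrite addnS -divn_eq.
rewrite nE modnMDl divnMDl//.
move: (n %% k)%N (n %/ k)%N tk => t q tk {nE}.
have e1 := @big_nat_recr R 1 *%R t 0 (fun i => rho R L i ^+ q.+1) (leq0n t).
have e2 := @big_ltn R 1 *%R t k (fun i => rho R L i ^+ q) tk.
rewrite e2 -mulrA [(_ * _) * rho _ _ _]mulrAC -exprSr mulrA -e1.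
(* If t + 1 = k the remainder returns to 0 and the quotient takes the carry; otherwise the quotient
   stays. *)
move: tk; rewrite leq_eqVlt => /orP[/eqP tk|tk]; last first.
  by rewrite modn_small// divn_small// addn0.
rewrite tk modnn divnn hk addn1 [in RHS](@big_geq _ _ _ k)// mulr1.
by rewrite [X in X * _]big_geq// mul1r.
Qed.

Lemma rho_weight0 : rho_weight R L 0 = 1.
Proof.
rewrite /rho_weight mod0n div0n big_geq// mul1r big1//.
Qed.

Lemma rho_weightD n : rho_weight R L (n + k) = rho_weight R L k * rho_weight R L n.
Proof.
elim: n => [|n ih]; first by rewrite add0n rho_weight0 mulr1.
by rewrite addSn !rho_weightS ih modnDr mulrA.
Qed.

Lemma rho_weight_ge n : 2 ^+ n <= rho_weight R L n.
Proof.
elim: n => [|n ih]; first by rewrite rho_weight0 expr0.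
by rewrite rho_weightS exprSr ler_pM// ?exprn_ge0//.
Qed.

Lemma rho_weight_gt0 n : 0 < rho_weight R L n.
Proof. by apply: lt_le_trans (rho_weight_ge n); rewrite exprn_gt0. Qed.

(** With denominators cleared, this is the additivity of M: a cylinder has the total mass of its
    extensions by j edges. *)
Lemma path_mass j n v :
  rho_weight R L n * \sum_(p <- paths_from L j n v) x (psrc v p) =
  rho_weight R L (n + j) * x v.
Proof.
elim: j n v => [|j ih] n v; first by rewrite addn0 big_seq1.
rewrite (big_paths_from_psrc L _ _ _ x).
have r0 : 0 < rho R L (n %% k) by apply: lt_le_trans (rho_mod_ge2 n).
apply: (mulfI (lt0r_neq0 r0)); rewrite mulrA [_ * rho_weight _ _ _]mulrC -rho_weightS.
rewrite big_distrr/= (eq_bigr (fun w => rho_weight R L (n + j.+1) *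
    ((nedges L (n %% k) v w)%:R * x w))); last first.
  by move=> w _; rewrite mulrCA ih addSnnS mulrCA.
by rewrite -big_distrr/= x_eigen ?ltn_mod// mulrCA.
Qed.

Variable delta : R.

(** The sum of [weight]^(delta s) over the extensions by j edges of one path of length n with source
    v. The weight is that of the whole path of length n + j, not of the added edges alone. *)
Definition path_sum (s : R) (j n : nat) (v : V) : R :=
  rho_weight R L (n + j) `^ (- s) *
  \sum_(p <- paths_from L j n v) x (psrc v p) `^ (delta * s).

Lemma path_sum_ge0 s j n v : 0 <= path_sum s j n v.
Proof. by rewrite mulr_ge0 ?powR_ge0// sumr_ge0// => p _; exact: powR_ge0. Qed.

Lemma path_sumS s j n v : path_sum s j.+1 n v =
  \sum_w (nedges L (n %% k) v w)%:R * path_sum s j n.+1 w.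
Proof.
rewrite /path_sum (big_paths_from_psrc L _ _ _ (fun v => x v `^ (delta * s))).
rewrite big_distrr/=; apply: eq_bigr => w _.
by rewrite addSnnS mulrCA.
Qed.

Lemma path_sumD s j n v :
  path_sum s j (n + k) v = rho_weight R L k `^ (- s) * path_sum s j n v.
Proof.
rewrite /path_sum addnAC rho_weightD powRM ?ltW ?rho_weight_gt0// -mulrA.
congr (_ * (_ * _)).
elim: j n v => [|j ih] n v; first by rewrite !big_seq1.
rewrite !big_paths_fromS -addSn; under eq_bigr do rewrite ih.
by congr (\sum_(_ <- _) _); rewrite /edges_from modnDr.
Qed.

Hypothesis delta0 : 0 < delta.

(** As x^(delta s) <= 1 <= x / min x, the powers of x may be replaced by multiples of x, to which
    [path_mass] applies. This leaves rho_weight(n + j)^(1 - s) / min x, and [rho_weight] grows at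
    least like powers of 2. *)
Lemma path_sum_le : exists K : R, forall s j n v, 1 < s ->
  path_sum s j n v <= K * (2 `^ (1 - s)) ^+ j.
Proof.
have [v0 v0P] := perron_min.
exists (x v0)^-1 => s j n v s1.
apply: (@le_trans _ _ (rho_weight R L (n + j) `^ (- s) *
    ((x v0)^-1 * \sum_(p <- paths_from L j n v) x (psrc v p)))).
  rewrite ler_wpM2l ?powR_ge0// big_distrr/=; apply: ler_sum => p _.
  rewrite [leRHS]mulrC ler_pdivlMr// (@le_trans _ _ (x v0))// ger_pMl//.
  apply: (@le_trans _ _ (1 `^ (delta * s))); last by rewrite powR1.
  rewrite ge0_ler_powR ?nnegrE ?perron_le1// ?ltW// mulr_gt0//.
  exact: lt_trans s1.
rewrite mulrCA ler_pM2l ?invr_gt0//.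
have := path_mass j n v; set S := \sum_(_ <- _) _ => Sm.
have S0 : 0 <= S by apply: sumr_ge0 => p _; exact: ltW.
have SW : S <= rho_weight R L (n + j).
  apply: (@le_trans _ _ (rho_weight R L n * S)).
    rewrite ler_peMl// (le_trans _ (rho_weight_ge n))// exprn_ege1//.
    by rewrite ler1n.
  by rewrite Sm ler_piMr ?perron_le1// ltW// rho_weight_gt0.
apply: (@le_trans _ _ (rho_weight R L (n + j) `^ (1 - s))).
  rewrite powRD ?(gt_eqF (rho_weight_gt0 _)) ?implybT//.
  rewrite powRr1 ?(ltW (rho_weight_gt0 _))//.
  by rewrite [leRHS]mulrC ler_wpM2l// powR_ge0.
rewrite -powR_mulrn ?powR_ge0// powRAC powR_mulrn//.
rewrite -opprB !powRN lef_pV2 ?posrE ?powR_gt0 ?rho_weight_gt0 ?exprn_gt0//.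
rewrite ge0_ler_powR ?nnegrE ?subr_ge0 ?exprn_ge0 ?(ltW s1) ?(ltW (rho_weight_gt0 _))//.
apply: le_trans (rho_weight_ge _); by rewrite ler_weXn2l ?ler1n// leq_addl.
Qed.

Definition path_series (s : R) (n : nat) (v : V) : \bar R :=
  (\sum_(0 <= j <oo) (path_sum s j n v)%:E)%E.

Definition path_zeta (s : R) (n : nat) (v : V) : R := fine (path_series s n v).

Lemma path_series_bound : exists K : R, forall s n v, 1 < s ->
  (0 <= path_series s n v <= (K / (1 - 2 `^ (1 - s)))%:E)%E.
Proof.
have [K Kb] := path_sum_le; exists K => s n v s1.
have q0 : 0 < (2 : R) `^ (1 - s) by rewrite powR_gt0.
have q1 : (2 : R) `^ (1 - s) < 1 by rewrite powR_lt1 ?ltr1n// subr_lt0.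
have K0 : 0 <= K.
  by have := Kb s 0 n v s1; rewrite expr0 mulr1; apply: le_trans; exact: path_sum_ge0.
apply/andP; split.
  by apply: nneseries_ge0 => j _ _; rewrite lee_fin path_sum_ge0.
have gc : series (geometric K (2 `^ (1 - s))) @ \oo --> K / (1 - 2 `^ (1 - s)).
  by apply: cvg_geometric_series; rewrite gtr0_norm.
apply: (@le_trans _ _ (\sum_(0 <= j <oo) (geometric K (2 `^ (1 - s)) j)%:E)%E).
  apply: lee_nneseries => [j _|j _]; rewrite lee_fin ?path_sum_ge0//.
  exact: Kb.
rewrite le_eqVlt; apply/orP; left; apply/eqP/cvg_lim => //.
rewrite (_ : (fun n => _) = EFin \o series (geometric K (2 `^ (1 - s)))).
  by apply: cvg_EFin => //; exact: nearW.
by apply/funext => m; rewrite /= sumEFin.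
Qed.

Lemma path_seriesE s n v : 1 < s -> path_series s n v = (path_zeta s n v)%:E.
Proof.
have [K Kb] := path_series_bound => s1; have /andP[h0 hK] := Kb s n v s1.
by rewrite fineK// ge0_fin_numE// (le_lt_trans hK)// ltry.
Qed.

(** The bound has a simple pole at s = 1, so (s - 1) [path_zeta] stays bounded near 1, as
    [perron_residue] requires. *)
Lemma path_zeta_bound : exists K : R, forall s n v, 1 < s ->
  0 <= path_zeta s n v <= K / (1 - 2 `^ (1 - s)).
Proof.
have [K Kb] := path_series_bound; exists K => s n v s1.
by have := Kb s n v s1; rewrite path_seriesE// !lee_fin.
Qed.

(** The empty continuation is split off and the others are sorted by their first edge. After k such
    steps the colours repeat, and [path_zetaD] closes the recursion into the renewal equation. *)
Lemma path_zetaS s n v : 1 < s -> path_zeta s n v =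
  rho_weight R L n `^ (- s) * x v `^ (delta * s) +
  \sum_w (nedges L (n %% k) v w)%:R * path_zeta s n.+1 w.
Proof.
move=> s1; apply: EFin_inj; rewrite -path_seriesE// /path_series.
rewrite nneseries_recl//; last by move=> j; rewrite lee_fin path_sum_ge0.
rewrite EFinD; congr (_ + _)%E; first by rewrite /path_sum addn0 big_seq1.
rewrite -(nneseries_addn 1); last by move=> j; rewrite lee_fin path_sum_ge0.
under eq_eseriesr do rewrite addn1 path_sumS -sumEFin.
rewrite nneseries_sum; last first.
  by move=> w j _; rewrite lee_fin mulr_ge0// path_sum_ge0.
rewrite -sumEFin; apply: eq_bigr => w _.
under eq_eseriesr do rewrite EFinM.
rewrite nneseriesZl; last by move=> j _; rewrite lee_fin path_sum_ge0.
by rewrite EFinM -path_seriesE.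
Qed.

Lemma path_zetaD s n v : 1 < s ->
  path_zeta s (n + k) v = rho_weight R L k `^ (- s) * path_zeta s n v.
Proof.
move=> s1; apply: EFin_inj; rewrite EFinM -!path_seriesE// /path_series.
rewrite -nneseriesZl; last by move=> j _; rewrite lee_fin path_sum_ge0.
by apply: eq_eseriesr => j _; rewrite path_sumD EFinM.
Qed.

End Asymptotics.

(** * Residues of the path series at s = 1 *)

Section Residue.
Variables (R : realType) (k : nat) (V : finType) (L : kgraph k V) (x : V -> R).
Hypotheses (hk : (0 < k)%N) (htwo : receives_two L) (hx : perron_vector L x).
Hypothesis hirr : irreducible_mx (\prod_(i < k) adjacency L i).
Variable delta : R.
Hypothesis delta0 : 0 < delta.

Let x_gt0 v : 0 < x v. Proof. by case: hx. Qed.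
Let x_eigen i v : (i < k)%N ->
  \sum_w (nedges L i v w)%:R * x w = rho R L i * x v.
Proof. by move=> ik; case: hx => _ _; apply. Qed.

Let toR (A : 'M[nat]_#|V|) : 'M[R]_#|V| := map_mx (fun m : nat => m%:R) A.
Let P j : 'M[nat]_#|V| := \prod_(i < j) adjacency L i.
Let xcol : 'cV[R]_#|V| := \col_a x (enum_val a).

Let toRM A B : toR (A * B) = toR A *m toR B.
Proof.
apply/matrixP => a b; rewrite !mxE natr_sum; apply: eq_bigr => c _.
by rewrite natrM !mxE.
Qed.

Let toR1 : toR 1 = 1%:M.
Proof. by apply/matrixP => a b; rewrite !mxE; case: eqP. Qed.

Let toRX A m : toR (A ^+ m) = toR A ^+ m.
Proof.
elim: m => [|m ih]; first by rewrite !expr0 toR1.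
by rewrite !exprS toRM ih.
Qed.

Let toR_ge0 A a b : 0 <= toR A a b.
Proof. by rewrite mxE. Qed.

Let PS j : toR (P j.+1) = toR (P j) *m toR (adjacency L j).
Proof. by rewrite /P big_ord_recr toRM. Qed.

Let adjE j (f : V -> R) : toR (adjacency L j) *m (\col_a f (enum_val a)) =
  \col_a \sum_w (nedges L j (enum_val a) w)%:R * f w.
Proof.
apply/matrixP => a b; rewrite !mxE [RHS](reindex (@enum_val V (mem V)))/=.
  by apply: eq_bigr => c _; rewrite !mxE.
by exists enum_rank => v _; [exact: enum_valK | exact: enum_rankK].
Qed.

Let P_eigen j : (j <= k)%N -> toR (P j) *m xcol = rho_weight R L j *: xcol.
Proof.
elim: j => [_|j ih jk].
  by rewrite /P big_ord0 toR1 mul1mx rho_weight0 scale1r.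
rewrite PS -mulmxA adjE.
have -> : (\col_a \sum_w (nedges L j (enum_val a) w)%:R * x w) = rho R L j *: xcol.
  by apply/matrixP => a b; rewrite !mxE x_eigen.
by rewrite -scalemxAr ih ?(ltnW jk)// scalerA (rho_weightS R L hk) modn_small// mulrC.
Qed.

Let zcol s n : 'cV[R]_#|V| := \col_a path_zeta L x delta s n (enum_val a).
Let scol s n : 'cV[R]_#|V| :=
  \col_a (rho_weight R L n `^ (- s) * x (enum_val a) `^ (delta * s)).
(** The contribution to [zcol s 0] of the paths with fewer than j edges; for j = k it is the source
    term of the renewal equation. *)
Let T s j : 'cV[R]_#|V| := \sum_(i < j) toR (P i) *m scol s i.

Let zcolE s j : 1 < s -> (j <= k)%N -> zcol s 0 = T s j + toR (P j) *m zcol s j.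
Proof.
move=> s1; elim: j => [_|j ih jk].
  by rewrite /T big_ord0 add0r /P big_ord0 toR1 mul1mx.
rewrite ih ?(ltnW jk)// /T big_ord_recr/= -addrA PS -mulmxA adjE -mulmxDr.
congr (_ + _ *m _); apply/matrixP => a b; rewrite !mxE.
by rewrite (path_zetaS hk htwo hx)// modn_small.
Qed.

Let scol_gt0 s n a : 0 < scol s n a 0.
Proof. by rewrite mxE mulr_gt0// powR_gt0// (rho_weight_gt0 hk htwo hx). Qed.

Let T_gt0 s j a : 0 < T s j.+1 a 0.
Proof.
rewrite /T big_ord_recl mxE ltr_pwDl//.
  by rewrite /P big_ord0 toR1 mul1mx.
rewrite summxE; apply: sumr_ge0 => i _; rewrite mxE; apply: sumr_ge0 => b _.
by rewrite mulr_ge0// ltW.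
Qed.

Let T_cvg j a : T s j a 0 @[s --> 1^'+] --> T 1 j a 0.
Proof.
under eq_fun do rewrite /T summxE.
rewrite /T summxE; apply: cvg_bigsum => i _.
under eq_fun do rewrite mxE.
rewrite mxE; apply: cvg_bigsum => b _; apply: cvgMr.
under eq_fun do rewrite mxE.
rewrite mxE; apply: cvgM; apply: cvg_powR_exp => //.
- exact: rho_weight_gt0 hk htwo hx _.
- by apply: cvgN; exact: cvg_at_right_filter.
- by apply: cvgMr; exact: cvg_at_right_filter.
Qed.

Let card_V : (0 < #|V|)%N.
Proof.
by apply/card_gt0P; have [v _] := perron_min hx; exists v.
Qed.

Lemma path_zeta_residue : exists2 C : R, 0 < C & forall n v,
  (s - 1) * path_zeta L x delta s n v @[s --> 1^'+] -->
  C / rho_weight R L n * x v.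
Proof.
have r1 : 1 < rho_weight R L k.
  apply: lt_le_trans (rho_weight_ge hk htwo hx k).
  by rewrite exprn_egt1 ?ltr1n// -lt0n.
have [K Kb] := path_zeta_bound hk htwo hx delta0.
have zk s : 1 < s -> zcol s k = rho_weight R L k `^ (- s) *: zcol s 0.
  move=> s1; apply/matrixP => a b; rewrite !mxE.
  by rewrite -[X in path_zeta _ _ _ _ X]add0n (path_zetaD hk htwo hx).
(* (s - 1) / (1 - 2^(1 - s)) tends to 1 / ln 2, so it is eventually at most 1 / ln 2 + 1. *)
have bnd : \forall s \near 1^'+, forall i, `|(s - 1) * zcol s 0 i 0| <=
    K * ((ln 2)^-1 + 1).
  have l2 : 1 < (2 : R) by rewrite ltr1n.
  have /cvgr_le/(_ ((ln 2)^-1 + 1)) := cvg_geometric_pole l2.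
  rewrite ltrDl ltr01 => /(_ isT) {}l2.
  near=> s.
  have s1 : 1 < s by near: s; exact: nbhs_right_gt.
  have sl : (s - 1) / (1 - 2 `^ (1 - s)) <= (ln 2)^-1 + 1.
    by near: s; exact: l2.
  move=> i; rewrite mxE; have /andP[z0 zK] := Kb s 0 (enum_val i) s1.
  rewrite ger0_norm; last by rewrite mulr_ge0// subr_ge0 ltW.
  have s10 : 0 < s - 1 by rewrite subr_gt0.
  have d0 : 0 < 1 - (2 : R) `^ (1 - s).
    by rewrite subr_gt0 powR_lt1 ?ltr1n// subr_lt0.
  have K0 : 0 <= K.
    rewrite -(pmulr_lge0 _ (_ : 0 < (1 - 2 `^ (1 - s))^-1)) ?invr_gt0//.
    exact: le_trans zK.
  apply: (@le_trans _ _ ((s - 1) * (K / (1 - 2 `^ (1 - s))))).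
    by rewrite ler_wpM2l// ltW.
  by rewrite mulrCA ler_wpM2l.
have irr i j : exists m : nat, 0 < (toR (P k) ^+ m) i j.
  have [m _ Pm] := hirr i j; exists m.
  by rewrite -toRX mxE ltr0n.
have [C C0 CP] : exists2 C, 0 < C &
    forall i, (s - 1) * zcol s 0 i 0 @[s --> 1^'+] --> C * xcol i 0.
  apply: (@perron_residue R #|V| (toR (P k)) xcol
    (rho_weight R L k) _ irr _ r1 _ (fun s => zcol s 0) (fun s => T s k)
    (T 1 k) (K * ((ln 2)^-1 + 1)) card_V).
  - exact: toR_ge0.
  - by move=> i; rewrite mxE.
  - exact: P_eigen.
  - by move=> s s1; rewrite {1}(zcolE s1 (leqnn k)) zk// -scalemxAr.
  - exact: T_cvg.
  - by move=> i; rewrite -(prednK hk); exact: T_gt0.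
  - exact: bnd.
exists C => //.
have W0 := rho_weight_gt0 hk htwo hx.
(* Levels divisible by k follow from level 0 by periodicity: each period contributes the factor
   rho_weight(k)^(-s). *)
have Q0 m v : (s - 1) * path_zeta L x delta s (m * k) v @[s --> 1^'+] -->
    C / rho_weight R L (m * k) * x v.
  elim: m => [|m ih].
    rewrite mul0n rho_weight0 divr1.
    have zE s : zcol s 0 (enum_rank v) 0 = path_zeta L x delta s 0 v.
      by rewrite mxE enum_rankK.
    have := CP (enum_rank v); rewrite [xcol _ _]mxE enum_rankK.
    by under eq_fun do rewrite zE.
  rewrite mulSn addnC (rho_weightD R L hk).
  have -> : C / (rho_weight R L k * rho_weight R L (m * k)) * x v =
      rho_weight R L k `^ (- 1) * (C / rho_weight R L (m * k) * x v).
    by rewrite powR_inv1 ?ltW// invfM mulrCA !mulrA.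
  have h : rho_weight R L k `^ (- s) * ((s - 1) * path_zeta L x delta s (m * k) v)
      @[s --> 1^'+] --> rho_weight R L k `^ (- 1) * (C / rho_weight R L (m * k) * x v).
    apply: cvgM => //; apply: cvg_powR_exp => //.
    by apply: cvgN; exact: cvg_at_right_filter.
  apply: (cvg_right1 _ h) => s s1.
  by rewrite (path_zetaD hk htwo hx)// mulrCA.
(* The other levels are reached downwards from a multiple of k, since [path_zetaS] expresses level m
   through level m + 1. Its first term is killed by s - 1, and the eigenvalue equation turns 1 /
   rho_weight(m + 1) into 1 / rho_weight(m). *)
have Qd n i v : (i <= n * k)%N ->
    (s - 1) * path_zeta L x delta s (n * k - i) v @[s --> 1^'+] -->
    C / rho_weight R L (n * k - i) * x v.
  elim: i v => [|i ih] v ik; first by rewrite subn0; exact: Q0.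
  move: ih; have -> : (n * k - i = (n * k - i.+1).+1)%N.
    by rewrite subnS prednK ?subn_gt0.
  move: (n * k - i.+1)%N => m ih.
  have -> : C / rho_weight R L m * x v =
     0 * rho_weight R L m `^ (-1) * x v `^ (delta * 1) +
     \sum_w (nedges L (m %% k) v w)%:R * (C / rho_weight R L m.+1 * x w).
    rewrite mul0r mul0r add0r.
    under eq_bigr do rewrite mulrCA.
    rewrite -big_distrr/= x_eigen ?ltn_mod// (rho_weightS R L hk).
    have r2 : 0 < rho R L (m %% k).
      by rewrite (lt_le_trans _ (rho_ge2 htwo hx _)) ?ltn_mod.
    rewrite mulrA; congr (_ * _).
    by rewrite -[RHS]mulrA [(_ * rho _ _ _)^-1]invfM divfK ?gt_eqF.
  have h : (s - 1) * rho_weight R L m `^ (- s) * x v `^ (delta * s) +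
     \sum_w (nedges L (m %% k) v w)%:R * ((s - 1) * path_zeta L x delta s m.+1 w)
     @[s --> 1^'+] --> 0 * rho_weight R L m `^ (-1) * x v `^ (delta * 1) +
     \sum_w (nedges L (m %% k) v w)%:R * (C / rho_weight R L m.+1 * x w).
    apply: cvgD.
      apply: cvgM; first apply: cvgM; first exact: cvg_subr1_right.
        apply: cvg_powR_exp => //.
        by apply: cvgN; exact: cvg_at_right_filter.
      by apply: cvg_powR_exp => //; apply: cvgMr; exact: cvg_at_right_filter.
    by apply: cvg_bigsum => w _; apply: cvgMr; apply: ih; exact: ltnW.
  apply: (cvg_right1 _ h) => s s1.
  rewrite (path_zetaS hk htwo hx)// mulrDr mulrA; congr (_ + _).
  by rewrite big_distrr/=; apply: eq_bigr => w _; rewrite mulrCA.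
move=> n v; have nk : (n <= n * k)%N by rewrite leq_pmulr.
by have := Qd n (n * k - n)%N v (leq_subr _ _); rewrite subKn.
Unshelve. all: by end_near.
Qed.

End Residue.

(** * Infinite paths and diameters *)

Section InfinitePaths.
Variables (k : nat) (V : finType) (L : kgraph k V).

(** Arbitrary starting levels are allowed so that tails of infinite paths are again of this form. *)
Definition inf_from (n : nat) (v : V) (y : nat -> bedge V) : Prop :=
  brng (y 0%N) = v /\
  forall i, bedge_at L (n + i) (y i) /\ bsrc (y i) = brng (y i.+1).

Definition cons_edge (e : bedge V) (y : nat -> bedge V) (i : nat) : bedge V :=
  if i is i'.+1 then y i' else e.

Lemma inf_from_cat n v p y : is_fin_path L n v p ->
  inf_from (n + size p) (psrc v p) y -> inf_from n v (foldr cons_edge y p).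
Proof.
elim: p n v => [|e p ih] n v /=; first by rewrite addn0.
move=> /and3P[/eqP ev eb pp]; rewrite -addSnnS => /(ih _ _ pp) [p0 pS].
split=> // -[|i] /=; first by rewrite addn0.
by rewrite -addSnnS; exact: pS.
Qed.

Lemma mkseqS_cons (T : Type) (f : nat -> T) n :
  mkseq f n.+1 = f 0%N :: mkseq (fun i => f i.+1) n.
Proof. by rewrite /mkseq /= -[1%N]/(1 + 0)%N iotaDl -map_comp. Qed.

Lemma mkseq_foldr_cons p y : mkseq (foldr cons_edge y p) (size p) = p.
Proof. by elim: p => //= e p ih; rewrite mkseqS_cons ih. Qed.

Lemma foldr_cons_edge p y : foldr cons_edge y p (size p) = y 0%N.
Proof. by elim: p. Qed.

Lemma inf_from_prefix n v y j : inf_from n v y ->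
  is_fin_path L n v (mkseq y j) /\ psrc v (mkseq y j) = brng (y j).
Proof.
elim: j n v y => [|j ih] n v y [y0 yS]; first by rewrite /psrc/=.
rewrite mkseqS_cons /= y0 eqxx /=.
have h : inf_from n.+1 (bsrc (y 0%N)) (fun i => y i.+1).
  split; first by have [_ <-] := yS 0%N.
  by move=> i; rewrite addSnnS; exact: yS.
have [p s] := ih _ _ _ h; split; last exact: s.
by rewrite p andbT -[n]addn0; have [] := yS 0%N.
Qed.

Lemma ipath_inf_from (y : inf_path L) : inf_from 0 (irng y) y.
Proof. by split=> // i; exact: ipath_edgeP. Qed.

Definition prefix (y : inf_path L) (n : nat) : fin_path L :=
  exist (fun p => is_fin_path L 0 p.1 p.2) (irng y, mkseq y n)
    (inf_from_prefix n (ipath_inf_from y)).1.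

Lemma flen_prefix y n : flen (prefix y n) = n.
Proof. by rewrite /flen /= size_mkseq. Qed.

Lemma fsrc_prefix y n : fsrc (prefix y n) = brng (y n).
Proof. exact: (inf_from_prefix n (ipath_inf_from y)).2. Qed.

Lemma cylinderE (l : fin_path L) y : cylinder l y <-> l = prefix y (flen l).
Proof.
split=> [ly|->]; first by apply: val_inj; rewrite /= ly.
by rewrite /cylinder /mkset flen_prefix.
Qed.

Lemma cylinder_prefix y n : cylinder (prefix y n) y.
Proof. by apply/cylinderE; rewrite flen_prefix. Qed.

Lemma ipath_eq (y z : inf_path L) : (forall n, y n = z n) -> y = z.
Proof.
case: y => y yP; case: z => z zP /= /funext yz; subst z.
by congr IPath; exact: Prop_irrelevance.
Qed.

Hypotheses (hk : (0 < k)%N) (htwo : receives_two L).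

Lemma size_edges_from n v :
  size (edges_from L n v) = (\sum_w nedges L (n %% k) v w)%N.
Proof.
rewrite size_allpairs_dep -big_enum sumnE big_map /=.
by apply: eq_bigr => w _; rewrite size_iota.
Qed.

Lemma two_edges n v : exists e e', [/\ e != e',
  brng e = v /\ bedge_at L n e & brng e' = v /\ bedge_at L n e'].
Proof.
have := htwo v (ltn_pmod n hk); rewrite -size_edges_from.
have := edges_from_uniq L n v.
case E : (edges_from L n v) => [|e [|e' s]]//=; rewrite inE negb_or.
move=> /andP[/andP[ee _] _] _; exists e, e'; split=> //.
  by have := mem_edges_from L n v e; rewrite E !inE eqxx => /esym/andP[/eqP].
by have := mem_edges_from L n v e'; rewrite E !inE eqxx orbT => /esym/andP[/eqP].
Qed.

Lemma inf_from_edge n e : bedge_at L n e ->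
  exists2 y, inf_from n (brng e) y & y 0%N = e.
Proof.
move=> en; have nxt m v : {e' | brng e' = v /\ bedge_at L m e'}.
  by apply: cid; have [e1 [_ [_ e1P _]]] := two_edges m v; exists e1.
pose y := fix y i := if i is j.+1 then projT1 (nxt (n + i)%N (bsrc (y j))) else e.
exists y => //; split=> // i; split.
  case: i => [|i]; first by rewrite addn0.
  exact: (projT2 (nxt (n + i.+1)%N (bsrc (y i)))).2.
by rewrite /= (projT2 (nxt (n + i.+1)%N (bsrc (y i)))).1.
Qed.

Lemma ipath_through (l : fin_path L) e : brng e = fsrc l ->
  bedge_at L (flen l) e -> exists2 y : inf_path L, cylinder l y & y (flen l) = e.
Proof.
case: l => -[v p] pv; rewrite /fsrc /flen /= => el eb.
have [y yP y0] := inf_from_edge eb; rewrite el in yP.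
have [h0 hS] := inf_from_cat pv yP.
exists (IPath hS); last by rewrite /= foldr_cons_edge.
by rewrite /cylinder /= /irng /= h0 /flen /= mkseq_foldr_cons.
Qed.

(** Two different edges leaving the end of [l] are continued to infinite paths; the common segment
    of these is exactly [l], so they realize the diameter of its cylinder. *)
Lemma branching (l : fin_path L) : exists y z : inf_path L,
  [/\ cylinder l y, cylinder l z & y (flen l) != z (flen l)].
Proof.
have [e [e' [ee [e1 e2] [e1' e2']]]] := two_edges (flen l) (fsrc l).
have [y yl ye] := ipath_through e1 e2.
have [z zl ze] := ipath_through e1' e2'.
by exists y, z; rewrite ye ze.
Qed.

End InfinitePaths.

Section Diameter.
Variables (R : realType) (k : nat) (V : finType) (L : kgraph k V) (x : V -> R).
Hypotheses (hk : (0 < k)%N) (htwo : receives_two L) (hx : perron_vector L x).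
Variable delta : R.
Hypothesis delta01 : 0 < delta < 1.

Let x_gt0 v : 0 < x v. Proof. by case: hx. Qed.

Lemma weight_gt0 (l : fin_path L) : 0 < weight x delta l.
Proof. by rewrite mulr_gt0// powR_gt0// (rho_weight_gt0 hk htwo hx). Qed.

Lemma perron_edge n (e : bedge V) : bedge_at L n e ->
  x (bsrc e) <= rho R L (n %% k) * x (brng e).
Proof.
rewrite /bedge_at => /(leq_ltn_trans (leq0n _)) e0.
case: hx => _ _ /(_ _ (ltn_pmod n hk) (brng e)) <-.
rewrite (bigD1 (bsrc e))//=; apply: ler_wpDr.
  by apply: sumr_ge0 => w _; rewrite mulr_ge0// ltW.
by rewrite ler_peMl ?ler1n// ltW.
Qed.

(** One more edge multiplies the first factor of the weight by rho_i^(-1/delta), at most rho_i^(-1)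
    because delta < 1 and rho_i >= 1, while by [perron_edge] the coordinate of x grows at most by
    the factor rho_i. *)
Lemma weight_prefix_homo (y : inf_path L) (m n : nat) : (m <= n)%N ->
  weight x delta (prefix y n) <= weight x delta (prefix y m).
Proof.
have /andP[d0 d1] := delta01; elim: n => [|n ih].
  by rewrite leqn0 => /eqP ->.
rewrite leq_eqVlt => /orP[/eqP ->//|]; rewrite ltnS => /ih; apply: le_trans.
rewrite /weight !flen_prefix !fsrc_prefix (rho_weightS R L hk).
have r2 : 2 <= rho R L (n %% k) by apply: (rho_ge2 htwo hx); rewrite ltn_mod.
have r0 : 0 < rho R L (n %% k) by rewrite (lt_le_trans _ r2).
have W0 := rho_weight_gt0 hk htwo hx n.
rewrite powRM ?(ltW W0) ?(ltW r0)// -mulrA ler_wpM2l ?powR_ge0//.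
rewrite powRN mulrC ler_pdivrMr ?powR_gt0//.
have [yb <-] := ipath_edgeP y n; apply: le_trans (perron_edge yb) _.
rewrite mulrC ler_wpM2l ?(ltW (x_gt0 _))// le1r_powR//.
  by rewrite (le_trans _ r2)// ler1n.
by rewrite invf_ge1// ltW.
Qed.

Lemma common_segmentP (y z : inf_path L) (l : fin_path L) :
  is_longest_common y z l -> common_segment y z = Some l.
Proof.
move=> lP; apply: xget_unique; first by exists l.
move=> _ [l' [yl' zl' l'max] <-]; congr Some; case: lP => yl zl lmax.
have e : flen l' = flen l by apply/eqP; rewrite eqn_leq lmax// l'max.
by have /cylinderE -> := yl'; rewrite e; apply/esym/cylinderE.
Qed.

Lemma longest_common (y z : inf_path L) (l : fin_path L) :
  cylinder l y -> cylinder l z -> y != z ->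
  exists2 n, (flen l <= n)%N & is_longest_common y z (prefix y n).
Proof.
move=> yl zl yz.
have [n0 n0P] : exists n, y n != z n.
  apply/not_existsP => h; move/eqP : yz; apply; apply: ipath_eq => n.
  by have /negP := h n; rewrite negbK => /eqP.
have [n nP nmin] := @find_ex_minn (fun n => y n != z n) (ex_intro _ n0 n0P).
have eqn i : (i < n)%N -> y i = z i.
  by move=> ni; apply/eqP; apply: contraTT ni => /nmin; rewrite -leqNgt.
have le_n l' : cylinder l' y -> cylinder l' z -> (flen l' <= n)%N.
  move=> yl' zl'; rewrite leqNgt; apply/negP => nl'.
  move: nP; suff -> : y n = z n by rewrite eqxx.
  have : mkseq y (flen l') = mkseq z (flen l').
    by move: yl' zl'; rewrite /cylinder /= => <- [_ ->].
  by move=> /(congr1 (fun s => nth (y n) s n)); rewrite !nth_mkseq.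
exists n; first exact: le_n.
split; first exact: cylinder_prefix; last by move=> l' yl' zl'; rewrite flen_prefix le_n.
apply/cylinderE; rewrite flen_prefix; apply: val_inj => /=; congr (_, _).
  by move: yl zl; rewrite /cylinder/= => <- [].
by apply/eq_in_map => i; rewrite mem_iota => /andP[_]; rewrite add0n => /eqn.
Qed.

(** The common segment of two distinct points of the cylinder extends [l], and weights do not
    increase along extensions; the two paths of [branching] attain the bound. *)
Lemma diamE (l : fin_path L) : diam x delta l = weight x delta l.
Proof.
have ub y z : cylinder l y -> cylinder l z -> ultradist x delta y z <= weight x delta l.
  move=> yl zl; rewrite /ultradist; case: eqP => [_|/eqP yz].
    exact: ltW (weight_gt0 l).
  have [n ln nP] := longest_common yl zl yz; rewrite (common_segmentP nP).
  by have /cylinderE -> := yl; exact: weight_prefix_homo.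
have [y [z [yl zl yz]]] := branching hk htwo l.
have yzl : is_longest_common y z l.
  split=> // l' yl' zl'; rewrite leqNgt; apply/negP => nl'.
  move: yz; suff -> : y (flen l) = z (flen l) by rewrite eqxx.
  have : mkseq y (flen l') = mkseq z (flen l').
    by move: yl' zl'; rewrite /cylinder /= => <- [_ ->].
  by move=> /(congr1 (fun s => nth (y (flen l)) s (flen l))); rewrite !nth_mkseq.
have yzE : ultradist x delta y z = weight x delta l.
  rewrite /ultradist (common_segmentP yzl); case: eqP => // yz'.
  by move: yz; rewrite yz' eqxx.
apply/eqP; rewrite eq_le; apply/andP; split.
  apply: ge_sup; first by exists (ultradist x delta y z); exists y => //; exists z.
  by move=> _ [y' y'l [z' z'l <-]]; exact: ub.
rewrite -yzE; apply: ub_le_sup; last by exists y => //; exists z.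
by exists (weight x delta l) => _ [y' y'l [z' z'l <-]]; exact: ub.
Qed.

End Diameter.

(** * Topology and measures on the path space *)

Section PathTopology.
Variables (k : nat) (V : finType) (L : kgraph k V).
Variable h : [set: inf_path L] !=set0.

Lemma cylinder_sub (l : fin_path L) y n : cylinder l y -> (flen l <= n)%N ->
  cylinder (prefix y n) `<=` cylinder l.
Proof.
move=> /cylinderE ->; rewrite !flen_prefix => ln z.
rewrite /cylinder /mkset !flen_prefix /= => -[yz e].
congr (_, _) => //; apply/eq_in_map => i; rewrite mem_iota add0n => /andP[_ il].
move/(congr1 (fun s => nth (y 0%N) s i)) : e; rewrite !nth_mkseq//.
all: exact: leq_trans il ln.
Qed.

Lemma open_cylinder (l : fin_path L) : @open (path_space h) (cylinder l).
Proof.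
exists [set cylinder l]; last by rewrite bigcup_set1.
move=> _ ->; exists [fset cylinder l]%fset.
  by move=> A /fset1P ->; rewrite inE; exists l.
by apply/seteqP; split=> [y yl|y ly A /fset1P ->//]; exact: (yl (cylinder l) (fset11 _)).
Qed.

(** Cylinders are declared only as a subbase. Those containing y are given by its prefixes, so
    finitely many of them all contain the cylinder of a sufficiently long prefix. *)
Lemma nbhs_cylinder (y : path_space h) (A : set (path_space h)) :
  nbhs y A <-> exists n, cylinder (prefix y n) `<=` A.
Proof.
split=> [|[n nA]]; last first.
  apply: filterS nA _; apply: open_nbhs_nbhs; split; first exact: open_cylinder.
  exact: cylinder_prefix.
rewrite nbhsE => -[B [[D DF DB] By] BA].
suff [n nB] : exists n, cylinder (prefix y n) `<=` B.
  by exists n; exact: subset_trans BA.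
move: By; rewrite -DB => -[E DE Ey].
have [F FD FE] := DF E DE.
suff [n nF] : exists n, forall G, G \in (F : seq _) -> cylinder (prefix y n) `<=` G.
  exists n => z zn; have Ez : E z by rewrite -FE => G /= GF; exact: nF zn.
  by exists E => //; exact: Ez.
have {FD FE} : forall G, G \in (F : seq _) ->
    exists2 l : fin_path L, cylinder l y & G = cylinder l.
  move=> G GF; have := FD G GF; rewrite inE => -[l _ lG]; exists l => //.
  have {}Ey : E y := Ey.
  by rewrite lG; move: Ey; rewrite -FE; apply.
elim: (F : seq _) => [|G s ih] GS; first by exists 0%N.
have [n nF] := ih (fun G' G's => GS G' (mem_behead (s := G :: s) G's)).
have [l ly Gl] := GS G (mem_head _ _).
exists (maxn n (flen l)) => G'; rewrite inE => /orP[/eqP ->|/nF nG'].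
  by rewrite Gl; apply: cylinder_sub => //; rewrite leq_maxr.
apply: subset_trans nG'; apply: cylinder_sub; first exact: cylinder_prefix.
by rewrite flen_prefix leq_maxl.
Qed.

Let T := borel_space h.

Lemma measurable_cylinder (l : fin_path L) : measurable (cylinder l : set T).
Proof. by apply: sub_sigma_algebra; exact: open_cylinder. Qed.

Lemma measurable_cylinders (P : set (fin_path L)) :
  measurable (\bigcup_(l in P) cylinder l : set T).
Proof.
rewrite bigcup_mkcond; apply: countable_bigcupT_measurable => [|l].
  exact: countableP.
by case: ifP => // _; exact: measurable_cylinder.
Qed.

(** The empty set is added to obtain a pi-system: two cylinders are nested or disjoint. *)
Definition cylinders : set (set T) := [set A | A = set0 \/ range (@cylinder k V L) A].

Lemma borel_cylinders : (@measurable _ T) = <<s cylinders >>.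
Proof.
apply/seteqP; split; last first.
  apply: smallest_sub; first exact: sigma_algebra_measurable.
  by move=> _ [->//|[l _ <-]]; exact: measurable_cylinder.
apply: smallest_sub; first exact: smallest_sigma_algebra.
move=> O oO; pose P := [set l : fin_path L | cylinder l `<=` O].
have -> : O = \bigcup_(l in P) cylinder l.
  apply/seteqP; split=> [y Oy|y [l lO ly]]; last exact: lO.
  have [n nO] : exists n, cylinder (prefix y n) `<=` O.
    by apply/nbhs_cylinder; exact: open_nbhs_nbhs.
  by exists (prefix y n) => //; exact: cylinder_prefix.
rewrite bigcup_mkcond.
apply: (@countable_bigcupT_measurable _
  (g_sigma_algebraType (cylinders : set (set (path_space h))))) => [|l].
  exact: countableP.
by case: ifP => // _; apply: sub_sigma_algebra; right; exists l.
Qed.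

Lemma setI_closed_cylinders : setI_closed cylinders.
Proof.
have nested (l l' : fin_path L) y : cylinder l y -> cylinder l' y ->
    (flen l <= flen l')%N -> cylinder l `&` cylinder l' = cylinder l'.
  move=> ly l'y ll'; apply/setIidr.
  by have /cylinderE -> := l'y; exact: cylinder_sub ly ll'.
move=> A B [->|[l _ <-]]; first by left; rewrite set0I.
move=> [->|[l' _ <-]]; first by left; rewrite setI0.
have [->|/set0P[y [ly l'y]]] := eqVneq (cylinder l `&` cylinder l') set0.
  by left.
right; case/orP: (leq_total (flen l) (flen l')) => ll'.
  by rewrite (nested _ _ y)//; exists l'.
by rewrite setIC (nested _ _ y)//; exists l.
Qed.

Section MeasureOnPaths.
Variable R : realType.

Lemma cylinder_measure_unique (m1 m2 : {measure set T -> \bar R}) :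
  (forall l : fin_path L, m1 (cylinder l) = m2 (cylinder l)) ->
  (forall l : fin_path L, (m1 (cylinder l) < +oo)%E) ->
  forall A, measurable A -> m1 A = m2 A.
Proof.
move=> m12 m1oo.
pose g n : set T :=
  if choice.unpickle n is Some l then cylinder (l : fin_path L) else set0.
apply: (measure_unique cylinders g).
- exact: borel_cylinders.
- exact: setI_closed_cylinders.
- by move=> n; rewrite /g; case: (choice.unpickle n) => [l|]; [right; exists l|left].
- apply/seteqP; split=> // y _; exists (choice.pickle (prefix y 0)) => //.
  by rewrite /g choice.pickleK; exact: cylinder_prefix.
- by move=> _ [->|[l _ <-]]; rewrite ?measure0.
- by move=> n; rewrite /g; case: (choice.unpickle n) => [l|]; rewrite ?measure0.
Qed.

Lemma measure_level (m : {measure set T -> \bar R}) n (A : set T) : measurable A ->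
  m A = (\sum_(l <- level L n) m (cylinder l `&` A))%E.
Proof.
move=> mA; rewrite fsbig_seq ?level_uniq//= -measure_fin_bigcup.
- congr (m _); rewrite -setI_bigcupl setIidr// => y Ay.
  exists (prefix y n); last exact: cylinder_prefix.
  by rewrite /= mem_level flen_prefix.
- exact: finite_seq.
- move=> l l' /=; rewrite !mem_level => /eqP ln /eqP l'n [y [[ly _] [l'y _]]].
  by have /cylinderE -> := ly; have /cylinderE -> := l'y; rewrite ln l'n.
- by move=> l _; apply: measurableI => //; exact: measurable_cylinder.
Qed.

(* The union of the cylinders of length n that meet both O and its complement;
   these sets decrease to the boundary of O. *)
Definition mixed (O : set T) (n : nat) : set T :=
  \bigcup_(l in [set l : fin_path L | [/\ flen l = n,
    cylinder l `&` O !=set0 & ~ (cylinder l `<=` O)]]) cylinder l.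

Lemma mixedE (O : set T) n (y : inf_path L) : mixed O n y <->
  cylinder (prefix y n) `&` O !=set0 /\ ~ (cylinder (prefix y n) `<=` O).
Proof.
split=> [[l [ln l1 l2] /cylinderE ly]|[y1 y2]]; first by rewrite -ln -ly.
by exists (prefix y n); [split=> //; exact: flen_prefix | exact: cylinder_prefix].
Qed.

Lemma bigcap_mixed (O : set T) : \bigcap_n mixed O n = topological_boundary O.
Proof.
apply/seteqP; split=> [y yO|y [yc yi] n _].
  split.
    move=> B /nbhs_cylinder[n nB].
    have [[z [zn zO]] _] := (mixedE O n y).1 (yO n I).
    by exists z; split=> //; exact: nB.
  move=> /nbhs_cylinder[n nO].
  by have [_] := (mixedE O n y).1 (yO n I); apply.
apply/mixedE; split.
  rewrite setIC; apply: yc; apply/nbhs_cylinder; by exists n.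
by move=> nO; apply: yi; apply/nbhs_cylinder; exists n.
Qed.

Lemma mixed_cvg0 (m : probability T R) (O : set T) :
  m (topological_boundary (h := h) O) = 0%E ->
  fine (m (mixed O n)) @[n --> \oo] --> (0 : R).
Proof.
move=> mO.
have mm n : measurable (mixed O n) by exact: measurable_cylinders.
have : (m \o mixed O) n @[n --> \oo] --> m (\bigcap_n mixed O n).
  apply: nonincreasing_cvg_mu => //.
  - by rewrite (le_lt_trans (probability_le1 _ _))// ltry.
  - exact: bigcap_measurableType.
  - move=> i j ij; apply/subsetPset => y /mixedE[y1 y2]; apply/mixedE.
    have sub : cylinder (prefix y j) `<=` cylinder (prefix y i).
      by apply: cylinder_sub; rewrite ?flen_prefix//; exact: cylinder_prefix.
    split; first by apply: subset_nonempty y1; exact: setSI.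
    by move=> yi; apply: y2; exact: subset_trans yi.
rewrite bigcap_mixed mO; exact: fine_cvg.
Qed.

End MeasureOnPaths.
End PathTopology.

(** The two bounding functions may change with e, and their limits need only be within e of l. Here
    each truncation length gives its own pair. *)
Lemma cvg_right1_squeeze (R : realType) (F : R -> R) (l : R) :
  (forall e, 0 < e -> exists g h : R -> R, exists a b : R,
    [/\ g s @[s --> 1^'+] --> a, h s @[s --> 1^'+] --> b,
        l - e <= a, b <= l + e &
        forall s, 1 < s -> g s <= F s <= h s]) ->
  F s @[s --> 1^'+] --> l.
Proof.
move=> H; apply/cvgrPdist_le => e e0.
have e20 : 0 < e / 2 by rewrite divr_gt0.
have [g [h [a [b [ga hb la lb gFh]]]]] := H _ e20.
near=> s.
have s1 : 1 < s by near: s; exact: nbhs_right_gt.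
have gs : a - e / 2 <= g s.
  by near: s; apply: (cvgr_ge _ ga); rewrite ltrBlDr ltrDl.
have hs : h s <= b + e / 2.
  by near: s; apply: (cvgr_le _ hb); rewrite ltrDl.
have /andP[gF Fh] := gFh s s1.
rewrite distrC ler_norml; apply/andP; split; lra.
Unshelve. all: by end_near.
Qed.

Lemma cylinder_extend k (V : finType) (L : kgraph k V) (l l' : fin_path L) p :
  val l' = ((val l).1, (val l).2 ++ p) -> cylinder l' `<=` cylinder l.
Proof.
move=> vl' y; rewrite /cylinder /mkset vl' => -[yr].
have -> : flen l' = (flen l + size p)%N by rewrite /flen vl' size_cat.
rewrite /mkseq iotaD map_cat => /eqP; rewrite eqseq_cat ?size_map ?size_iota//.
by move=> /andP[/eqP -> _]; rewrite yr -surjective_pairing.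
Qed.

(** * Dixmier traces of sets with null boundary *)

Section TraceBounds.
Variables (R : realType) (k : nat) (V : finType) (L : kgraph k V) (x : V -> R).
Hypotheses (hk : (0 < k)%N) (htwo : receives_two L) (hx : perron_vector L x).
Variable delta : R.
Hypothesis delta01 : 0 < delta < 1.
Variable tau : fin_path L -> inf_path L * inf_path L.
Hypothesis htau : choice_function x delta tau.
Variable O : set (inf_path L).

Let delta0 : 0 < delta. Proof. by case/andP: delta01. Qed.
Let x_gt0 v : 0 < x v. Proof. by case: hx. Qed.
Let W0 n : 0 < rho_weight R L n. Proof. exact: rho_weight_gt0 hk htwo hx n. Qed.

Let F (s : R) (l : fin_path L) : R :=
  rho_weight R L (flen l) `^ (- s) * x (fsrc l) `^ (delta * s) * hits R tau O l.

Let hits_ge0 (l : fin_path L) : 0 <= hits R tau O l.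
Proof. by rewrite addr_ge0. Qed.

Let hits_le2 (l : fin_path L) : hits R tau O l <= 2.
Proof.
rewrite /hits !indicE; do 2![case: (_ \in _)];
  by rewrite ?addr0 ?add0r ?ler1n ?ler0n.
Qed.

Let F_ge0 s l : 0 <= F s l.
Proof. by rewrite !mulr_ge0 ?powR_ge0. Qed.

Let trace_F s : 1 < s ->
  block_trace (block_pow (block_mul (pi_rep tau (\1_O : inf_path L -> R))
    (abs_dirac_pow L x delta)) s) = (\esum_(l in [set: fin_path L]) (F s l)%:E)%E.
Proof.
move=> s1; rewrite /block_trace; apply: eq_esum => l _; congr _%:E.
have w0 := weight_gt0 hk htwo hx delta l.
rewrite trace_dixmier; last 2 first.
- by rewrite gt_eqF// (lt_trans _ s1).
- by rewrite (diamE hk htwo hx delta01).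
rewrite (diamE hk htwo hx delta01); congr (_ * _).
rewrite /weight powRM ?powR_ge0 ?(ltW (x_gt0 _))// -powRrM.
by rewrite mulrA mulNr mulVf ?gt_eqF// mulN1r.
Qed.

Let inside (l : fin_path L) : R := 2 * (`[< cylinder l `<=` O >])%:R.
Let touching (l : fin_path L) : R := 2 * (`[< cylinder l `&` O !=set0 >])%:R.

(** Both points of tau(l') lie in [l'], hence in [l]; only whether [l] is inside O or meets O
    matters, whatever the choice function. *)
Let hits_extend (l l' : fin_path L) : cylinder l' `<=` cylinder l ->
  inside l <= hits R tau O l' <= touching l.
Proof.
move=> ll'; have [t1 t2 _] := htau l'.
have {}t1 := ll' _ t1; have {}t2 := ll' _ t2.
apply/andP; split.
  rewrite /inside; case: asboolP => lO; last by rewrite mulr0.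
  by rewrite /hits !indicE !mem_set ?mulr1//; exact: lO.
rewrite /touching; case: asboolP => lO; first by rewrite mulr1.
rewrite mulr0 /hits !indicE !memNset ?addr0// => tO; apply: lO.
  by exists (tau l').2.
by exists (tau l').1.
Qed.

Let level_bounds s i N : 
  \sum_(l <- level L N) inside l * path_sum L x delta s i N (fsrc l) <=
  \sum_(l <- level L (N + i)) F s l <=
  \sum_(l <- level L N) touching l * path_sum L x delta s i N (fsrc l).
Proof.
have key (l : fin_path L) : l \in level L N ->
    inside l * path_sum L x delta s i N (fsrc l) <=
    \sum_(p <- paths_from L i N (fsrc l)) oapp (F s) 0 (extend l p) <=
    touching l * path_sum L x delta s i N (fsrc l).
  rewrite mem_level => /eqP lN; rewrite /path_sum mulrCA [X in _ <= _ <= X]mulrCA.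
  rewrite !big_distrr/= big_seq [X in _ <= X <= _]big_seq [X in _ <= _ <= X]big_seq.
  have b p : p \in paths_from L i N (fsrc l) ->
    rho_weight R L (N + i) `^ (- s) * (inside l * x (psrc (fsrc l) p) `^ (delta * s)) <=
    oapp (F s) 0 (extend l p) <=
    rho_weight R L (N + i) `^ (- s) * (touching l * x (psrc (fsrc l) p) `^ (delta * s)).
    rewrite -lN => /extendP[l' [-> vl' fl' sl']] /=.
    have sub := cylinder_extend vl'.
    have /andP[h1 h2] := hits_extend sub.
    rewrite /F fl' sl' -(mulrA _ _ (hits _ _ _ _)) [_ * hits _ _ _ _]mulrC.
    by rewrite !ler_wpM2l ?powR_ge0// !ler_wpM2r ?powR_ge0.
  by apply/andP; split; apply: ler_sum => p /b /andP[].
rewrite big_level big_seq [X in _ <= X <= _]big_seq [X in _ <= _ <= X]big_seq.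
by apply/andP; split; apply: ler_sum => l /key /andP[].
Qed.

(** Paths of length at least N are sorted by their initial segment of length N. The shorter ones
    contribute at most [H], uniformly in s, which the factor s - 1 sends to 0. *)
Lemma trace_bounds N : exists H : R, forall s, 1 < s ->
  exists2 t : R, block_trace (block_pow (block_mul
    (pi_rep tau (\1_O : inf_path L -> R)) (abs_dirac_pow L x delta)) s) = t%:E &
  \sum_(l <- level L N) inside l * path_zeta L x delta s N (fsrc l) <= t <=
  H + \sum_(l <- level L N) touching l * path_zeta L x delta s N (fsrc l).
Proof.
(* Each path contributes at most 2, since [rho_weight] is at least 1, x is at most 1 and [hits] is
   at most 2. *)
exists (\sum_(0 <= j < N) \sum_(l <- level L j) 2) => s s1.
set T := block_trace _.
have TE : T = ((\sum_(0 <= j < N) \sum_(l <- level L j) F s l)%:E +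
    \sum_(0 <= i <oo) (\sum_(l <- level L (N + i)) F s l)%:E)%E.
  rewrite /T trace_F// esum_level// (nneseries_split 0 N); last first.
    by move=> j _; rewrite lee_fin sumr_ge0.
  rewrite add0n sumEFin -nneseries_addn; last first.
    by move=> j; rewrite lee_fin sumr_ge0.
  by under [in RHS]eq_eseriesr do rewrite addnC.
have zetaE (c : fin_path L -> R) : (forall l, 0 <= c l) ->
  (\sum_(0 <= i <oo) (\sum_(l <- level L N) c l * path_sum L x delta s i N (fsrc l))%:E
   = (\sum_(l <- level L N) c l * path_zeta L x delta s N (fsrc l))%:E)%E.
  move=> c0; under eq_eseriesr do rewrite -sumEFin.
  have p0 := path_sum_ge0 L x delta.
  rewrite nneseries_sum; last by move=> l i _; rewrite lee_fin mulr_ge0// p0.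
  rewrite -sumEFin; apply: eq_bigr => l _.
  under eq_eseriesr do rewrite EFinM.
  rewrite nneseriesZl; last by move=> i _; rewrite lee_fin p0.
  by rewrite EFinM -(path_seriesE hk htwo hx delta0).
have in0 l : 0 <= inside l by rewrite mulr_ge0.
have to0 l : 0 <= touching l by rewrite mulr_ge0.
have head0 : 0 <= \sum_(0 <= j < N) \sum_(l <- level L j) F s l.
  by apply: sumr_ge0 => j _; apply: sumr_ge0.
have headH : \sum_(0 <= j < N) \sum_(l <- level L j) F s l <=
    \sum_(0 <= j < N) \sum_(l <- level L j) 2.
  apply: ler_sum => j _; apply: ler_sum => l _.
  rewrite -[leRHS]mul1r ler_pM// ?mulr_ge0 ?powR_ge0//.
  rewrite -[leRHS]mul1r ler_pM ?powR_ge0//.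
    rewrite powRN invf_le1 ?powR_gt0//.
    apply: (@le_trans _ _ (1 `^ s)); first by rewrite powR1.
    rewrite ge0_ler_powR ?nnegrE ?(ltW (W0 _)) ?(ltW (lt_trans _ s1))//.
    by rewrite (le_trans _ (rho_weight_ge hk htwo hx _))// exprn_ege1// ler1n.
  apply: (@le_trans _ _ (1 `^ (delta * s))); last by rewrite powR1.
  rewrite ge0_ler_powR ?nnegrE ?(perron_le1 hx) ?(ltW (x_gt0 _))// ltW//.
  by rewrite mulr_gt0// (lt_trans _ s1).
set lo := \sum_(l <- _) inside l * _; set hi := \sum_(l <- _) touching l * _.
have tail_lo : (lo%:E <= \sum_(0 <= i <oo) (\sum_(l <- level L (N + i)) F s l)%:E)%E.
  rewrite -zetaE//; apply: lee_nneseries => [i _ _|i _]; rewrite lee_fin.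
    apply: sumr_ge0 => l _; rewrite mulr_ge0//; exact: path_sum_ge0.
  by have /andP[] := level_bounds s i N.
have tail_hi : (\sum_(0 <= i <oo) (\sum_(l <- level L (N + i)) F s l)%:E <= hi%:E)%E.
  rewrite -zetaE//; apply: lee_nneseries => [i _ _|i _]; rewrite lee_fin.
    exact: sumr_ge0.
  by have /andP[] := level_bounds s i N.
move: tail_lo tail_hi TE.
case: (\sum_(0 <= i <oo) _)%E => [r| |]//; rewrite !lee_fin => lor rhi ->.
exists (\sum_(0 <= j < N) \sum_(l <- level L j) F s l + r) => //.
apply/andP; split; first by rewrite (le_trans lor)// lerDr.
exact: lerD.
Qed.

End TraceBounds.

Section DixmierLimit.
Variables (R : realType) (k : nat) (V : finType) (L : kgraph k V) (x : V -> R).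
Hypotheses (hk : (0 < k)%N) (htwo : receives_two L) (hx : perron_vector L x).
Hypothesis hirr : irreducible_mx (\prod_(i < k) adjacency L i).
Variable h : [set: inf_path L] !=set0.
Variable M : probability (borel_space h) R.
Hypothesis hM : is_M x M.
Variable delta : R.
Hypothesis delta01 : 0 < delta < 1.

Let m (A : set (borel_space h)) : R := fine (M A).

Let mE A : measurable A -> M A = (m A)%:E.
Proof. by move=> mA; rewrite fineK// fin_num_measure. Qed.

Let m_ge0 A : 0 <= m A. Proof. exact: fine_ge0. Qed.

Let m_le A B : measurable A -> measurable B -> A `<=` B -> m A <= m B.
Proof.
by move=> mA mB AB; rewrite -lee_fin -!mE//; apply: le_measure => //; rewrite inE.
Qed.

Let m_cyl (l : fin_path L) : m (cylinder l) = (rho_weight R L (flen l))^-1 * x (fsrc l).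
Proof. by rewrite /m hM. Qed.

Let m_level N A : measurable A -> m A = \sum_(l <- level L N) m (cylinder l `&` A).
Proof.
move=> mA; apply: EFin_inj; rewrite -mE// (measure_level M N mA) -sumEFin.
apply: eq_bigr => l _; apply: mE; apply: measurableI => //.
exact: measurable_cylinder.
Qed.

(* Cylinders of length N that are neither inside O nor disjoint from O lie in
   mixed O N. *)
Let sandwich O N : measurable O ->
  m O - m (mixed O N) <=
    \sum_(l <- level L N) (`[< cylinder l `<=` O >])%:R * m (cylinder l) /\
  \sum_(l <- level L N) (`[< cylinder l `&` O !=set0 >])%:R * m (cylinder l)
    <= m O + m (mixed O N).
Proof.
move=> mO; have mX : measurable (mixed O N) by exact: measurable_cylinders.
have mC (l : fin_path L) : measurable (cylinder l : set (borel_space h)).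
  exact: measurable_cylinder.
have mixedI (l : fin_path L) : l \in level L N -> cylinder l `&` O !=set0 ->
    ~ (cylinder l `<=` O) -> cylinder l `&` mixed O N = cylinder l.
  by rewrite mem_level => /eqP lN lO lO'; apply/setIidl => y ly; exists l.
rewrite (m_level N mO) (m_level N mX) lerBlDr -!big_split /=.
rewrite big_seq [X in _ <= X]big_seq [X in _ /\ X <= _]big_seq.
rewrite [X in _ /\ _ <= X]big_seq; split; apply: ler_sum => l lN.
- case: asboolP => lO.
    by rewrite mul1r (setIidl lO) lerDl.
  rewrite mul0r add0r; have [->|/set0P lO2] := eqVneq (cylinder l `&` O) set0.
    by rewrite /m measure0 m_ge0.
  rewrite mixedI//; apply: m_le => //; exact: measurableI.
- case: asboolP => lO; last by rewrite mul0r addr_ge0.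
  rewrite mul1r; have [lO'|lO'] := pselect (cylinder l `<=` O).
    by rewrite (setIidl lO') lerDl.
  by rewrite mixedI// lerDr.
Qed.

(** The constant is fixed before tau and O, so it is the same for a set and for the whole space and
    cancels in the normalization. *)
Lemma dixmier_cvg : exists2 C : R, 0 < C &
  forall (tau : fin_path L -> inf_path L * inf_path L) (O : set (borel_space h)),
  choice_function x delta tau -> measurable O ->
  M (topological_boundary O) = 0%E ->
  dixmier_on x delta tau O = (C%:E * M O)%E.
Proof.
have delta0 : 0 < delta by case/andP: delta01.
have [C C0 CP] := path_zeta_residue hk htwo hx hirr delta0.
(* The factor 2 counts the two points tau_+ and tau_- of each path. *)
exists (2 * C); first by rewrite mulr_gt0.
move=> tau O htau mO dO; rewrite mE// -EFinM /dixmier_on /dixmier_trace.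
pose tr (s : R) := block_trace (block_pow (block_mul
  (pi_rep tau (\1_O : inf_path L -> R)) (abs_dirac_pow L x delta)) s).
have trE N := trace_bounds hk htwo hx delta01 htau O N.
suff cF : (s - 1) * fine (tr s) @[s --> 1^'+] --> 2 * C * m O.
  apply/cvg_lim => //.
  (* Any truncation shows that the trace is finite for s > 1, so that [fine] loses nothing. *)
  have [H HP] := trE 0%N.
  apply: (@cvg_trans _ (((s - 1) * fine (tr s))%:E @[s --> 1^'+])); last first.
    by apply: cvg_EFin => //; exact: nearW.
  apply: near_eq_cvg; near=> s.
  have s1 : 1 < s by near: s; exact: nbhs_right_gt.
  by have [t trt _] := HP s s1; rewrite /tr trt EFinM.
apply: cvg_right1_squeeze => e e0.
have [N NP] : exists N, 2 * C * m (mixed O N) <= e.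
  have /cvgr_le/(_ (e / (2 * C))) := mixed_cvg0 dO.
  rewrite divr_gt0 ?mulr_gt0// => /(_ isT) [N _ /(_ N (leqnn N))] /= NP.
  by exists N; rewrite mulrC -ler_pdivlMr ?mulr_gt0.
have [H HP] := trE N.
have [lo hi] := sandwich N mO.
have lim (c : fin_path L -> bool) :
    \sum_(l <- level L N) 2 * (c l)%:R * ((s - 1) * path_zeta L x delta s N (fsrc l))
    @[s --> 1^'+] --> 2 * C * \sum_(l <- level L N) (c l)%:R * m (cylinder l).
  rewrite big_distrr/= big_seq.
  under eq_fun do rewrite big_seq.
  apply: cvg_bigsum => l; rewrite mem_level => /eqP lN.
  have -> : 2 * C * ((c l)%:R * m (cylinder l)) =
      2 * (c l)%:R * (C / rho_weight R L N * x (fsrc l)).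
    by rewrite m_cyl lN; ring.
  by apply: cvgMr; exact: CP.
exists (fun s => \sum_(l <- level L N) 2 * (`[< cylinder l `<=` O >])%:R *
  ((s - 1) * path_zeta L x delta s N (fsrc l))).
exists (fun s => (s - 1) * H + \sum_(l <- level L N)
  2 * (`[< cylinder l `&` O !=set0 >])%:R *
  ((s - 1) * path_zeta L x delta s N (fsrc l))).
exists (2 * C * \sum_(l <- level L N) (`[< cylinder l `<=` O >])%:R * m (cylinder l)).
exists (0 * H + 2 * C * \sum_(l <- level L N)
  (`[< cylinder l `&` O !=set0 >])%:R * m (cylinder l)).
have CC : 0 < 2 * C by rewrite mulr_gt0.
split.
- exact: lim.
- apply: cvgD; last exact: lim.
  by apply: cvgMl; exact: cvg_subr1_right.
- apply: (@le_trans _ _ (2 * C * (m O - m (mixed O N)))).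
    by rewrite mulrBr lerB.
  by rewrite ler_pM2l.
- rewrite mul0r add0r; apply: (@le_trans _ _ (2 * C * (m O + m (mixed O N)))).
    by rewrite ler_pM2l.
  by rewrite mulrDr lerD.
- move=> s s1; have [t trt /andP[t1 t2]] := HP s s1; rewrite /tr trt /=.
  have s10 : 0 <= s - 1 by rewrite subr_ge0 ltW.
  apply/andP; split.
    under eq_bigr do rewrite mulrCA.
    by rewrite -big_distrr/= ler_wpM2l.
  under eq_bigr do rewrite mulrCA.
  by rewrite -big_distrr/= -mulrDr ler_wpM2l.
Unshelve. all: by end_near.
Qed.

Lemma dixmier_onT (tau : fin_path L -> inf_path L * inf_path L) :
  dixmier_on x delta tau setT = dixmier_trace (abs_dirac_pow L x delta).
Proof.
congr dixmier_trace; apply/funext => l; rewrite /block_mul.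
have -> : pi_rep tau (\1_setT : inf_path L -> R) l = 1%:M.
  apply/matrixP => i j; rewrite !mxE !indicT.
  by rewrite if_same.
by rewrite mul1mx.
Qed.

End DixmierLimit.

(** * Identification of the normalized measure with M *)

Theorem theorem3p26 (R : realType) (k : nat) (V : finType) (L : kgraph k V)
    (x : V -> R)
    (hk : (0 < k)%N)
    (hfin : finite_kgraph L)
    (hsc : strongly_connected L)
    (htwo : receives_two L)
    (hirr : irreducible_mx (\prod_(i < k) adjacency L i))
    (hx : perron_vector L x)
    (M : probability (borel_space (path_space_neq0 hk htwo hx)) R)
    (hM : is_M x M) :
  (forall (delta : R) (tau : fin_path L -> inf_path L * inf_path L)
      (mu : {finite_measure
         set (borel_space (path_space_neq0 hk htwo hx)) -> \bar R}),
    0 < delta < 1 -> is_mu x delta tau mu ->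
    [/\ exists nu : probability (borel_space (path_space_neq0 hk htwo hx)) R,
          forall O, measurable O -> nu O = normalization mu O,
        forall O, measurable O -> normalization mu O = M O &
        forall O, measurable O -> M (topological_boundary O) = 0%E ->
          normalization mu O =
          (dixmier_on x delta tau O /
           dixmier_trace (abs_dirac_pow L x delta))%E]) /\
  (forall (delta1 delta2 : R) (tau1 tau2 : fin_path L -> inf_path L * inf_path L)
      (mu1 mu2 : {finite_measure
         set (borel_space (path_space_neq0 hk htwo hx)) -> \bar R}),
    0 < delta1 < 1 -> 0 < delta2 < 1 ->
    is_mu x delta1 tau1 mu1 -> is_mu x delta2 tau2 mu2 ->
    forall O, measurable O -> normalization mu1 O = normalization mu2 O).
Proof.
pose T := borel_space (path_space_neq0 hk htwo hx).
have boundary0 (O : set T) : (forall y, exists n, cylinder (prefix y n) `<=` O \/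
    cylinder (prefix y n) `&` O = set0) -> topological_boundary O = set0.
  move=> OP; rewrite -bigcap_mixed -subset0 => y yO; have [n] := OP y.
  by have /mixedE[[z zO] y2] := yO n I; case=> // e; move: zO; rewrite e.
have boundary_cylinder (l : fin_path L) :
    @topological_boundary _ _ _ (path_space_neq0 hk htwo hx) (cylinder l) = set0.
  apply: boundary0 => y; exists (flen l).
  have [yl|yl] := pselect (cylinder l y).
    by left; have /cylinderE {2}-> := yl.
  right; rewrite -subset0 => z [zy /cylinderE zl]; apply: yl.
  have /cylinderE := zy; rewrite flen_prefix -zl => /esym zyl; exact/cylinderE.
have boundaryT : @topological_boundary _ _ _ (path_space_neq0 hk htwo hx) setT = set0.
  by apply: boundary0 => y; exists 0%N; left.
have div (C m : R) : 0 < C -> ((C * m)%:E / C%:E)%E = m%:E.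
  by move=> C0; rewrite inver gt_eqF// -EFinM mulrC mulKf ?gt_eqF.
have fM (O : set T) : measurable O -> M O = (fine (M O))%:E.
  by move=> mO; rewrite fineK// fin_num_measure.
have main (delta : R) (tau : fin_path L -> inf_path L * inf_path L)
    (mu : {finite_measure set T -> \bar R}) :
    0 < delta < 1 -> is_mu x delta tau mu ->
    (forall O, measurable O -> normalization mu O = M O) /\
    (forall O, measurable O -> M (topological_boundary O) = 0%E ->
      M O = (dixmier_on x delta tau O /
             dixmier_trace (abs_dirac_pow L x delta))%E).
  move=> delta01 [htau muE].
  have [C C0 CP] := dixmier_cvg hk htwo hx hirr hM delta01.
  (* Cylinders are clopen, so their boundary is empty and their Dixmier trace is C times their
     M-measure. Uniqueness on the pi-system then extends the equality to all Borel sets, also those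
     whose boundary has positive measure. *)
  have muC O : measurable O -> mu O = (C%:E * M O)%E.
    move=> mO; rewrite -[RHS]/(mscale (NngNum (ltW C0)) M O).
    apply: cylinder_measure_unique mO => l; last first.
      by rewrite ltey_eq fin_num_measure//; exact: measurable_cylinder.
    apply: etrans (muE l) _; apply: CP => //; first exact: measurable_cylinder.
    by rewrite boundary_cylinder measure0.
  split=> O mO.
    rewrite /normalization !muC// probability_setT mule1 fM// -EFinM.
    exact: div.
  move=> dO; rewrite -(dixmier_onT x delta tau) !CP//.
    by rewrite probability_setT mule1 fM// -EFinM div.
  by rewrite boundaryT measure0.
split=> [delta tau mu delta01 muP|delta1 delta2 tau1 tau2 mu1 mu2 d1 d2 mu1P mu2P O mO].
  have [nM nD] := main _ _ _ delta01 muP.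
  split=> //; first by exists M => O mO; rewrite nM.
  by move=> O mO dO; rewrite nM// (nD _ mO dO).
by rewrite (main _ _ _ d1 mu1P).1// (main _ _ _ d2 mu2P).1.
Qed.
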